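(* Let $H$ be the graph on vertex set $\{0,1,2,3\}$ with red edge set $\{\{0,1\},\{0,2\},\{0,3\}\}$ and blue edge set $\{\{1,3\}\}$. Then $$\lambda_H=\frac{-171\sqrt{57}+7879}{43904}$$ and the semi-inducibility problem for $H$ is perfectly $K_5$-stable.
   Context: All graphs are finite and simple; the order of a graph is its number of vertices. For a graph $H$ with $\kappa$ vertices whose edges are coloured red or blue and an uncoloured graph $G$ of order $n\ge\kappa$, an embedding of $H$ into $G$ is an injection $V(H)\to V(G)$ that maps red edges of $H$ to edges of $G$ and blue edges of $H$ to non-edges of $G$ (pairs of distinct non-adjacent vertices). $\Lambda_H(G)$ is the number of embeddings, $\lambda_H(G):=\Lambda_H(G)/\big(n(n-1)\cdots(n-\kappa+1)\big)$, $\lambda_H(n)$ is the maximum of $\lambda_H(G)$ over all graphs $G$ of order $n$, and $\lambda_H:=\lim_{n\to\infty}\lambda_H(n)$ (the limit exists). For a graph $B$ on $\{0,\dots,m-1\}$ and pairwise disjoint finite sets $V_0,\dots,V_{m-1}$ (some possibly empty), the blowup $B(V_0,\dots,V_{m-1})$ is the graph on $\bigcup_i V_i$ in which $x\in V_i$ and $y\in V_j$ are adjacent if and only if $\{i,j\}\in E(B)$. The edit distance $\delta_{\mathrm{edit}}(G,G')$ between two graphs of the same order is the minimum of $|f(E(G))\bigtriangleup E(G')|$ over all bijections $f:V(G)\to V(G')$. The semi-inducibility problem for $H$ is perfectly $B$-stable if there is $C>0$ such that for every graph $G$ of order $n\ge C$ there is a blowup $G'$ of $B$ of order $n$ with $\delta_{\mathrm{edit}}(G,G')\le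 C\,(\lambda_H(n)-\lambda_H(G))\,n^2$. (Here $C\ge\kappa$ may be assumed.) *)

(* Defs.v *)
From HB Require Import structures.
From mathcomp Require Import all_boot all_order all_algebra all_fingroup.
From mathcomp Require Import all_classical all_reals all_analysis.
Set Implicit Arguments.
Unset Strict Implicit.
Unset Printing Implicit Defensive.
Import Order.TTheory GRing.Theory Num.Theory.
Import numFieldNormedType.Exports.

(* A finite simple graph on T is given by its edges, as two-element sets. *)
Record sgraph (T : finType) := SGraph {
  edges :> {set {set T}};
  edges_card2 : [forall e in edges, #|e| == 2] }.

HB.instance Definition _ (T : finType) := [isSub for @edges T].
HB.instance Definition _ (T : finType) := [Finite of sgraph T by <:].

Definition adj (T : finType) (G : sgraph T) (x y : T) : bool :=
  [set x; y] \in edges G.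

Lemma complete_card2 (T : finType) :
  [forall e in [set e : {set T} | #|e| == 2], #|e| == 2].
Proof. by apply/forall_inP => e; rewrite inE. Qed.

Definition complete (T : finType) : sgraph T := SGraph (complete_card2 T).

Record cgraph (T : finType) := CGraph {
  red : sgraph T;
  blue : sgraph T;
  red_blue_disjoint : [disjoint edges red & edges blue] }.

Section Semiinducibility.
Variables (R : realType) (k : nat) (H : cgraph 'I_k).

(* By injectivity the image of a blue edge is a pair of distinct vertices. *)
Definition is_embedding (T : finType) (G : sgraph T) (f : {ffun 'I_k -> T}) :
    bool :=
  [&& injectiveb f,
      [forall e in edges (red H), f @: e \in edges G] &
      [forall e in edges (blue H), f @: e \notin edges G]].

Definition num_embeddings (T : finType) (G : sgraph T) : nat :=
  #|[set f | is_embedding G f]|.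

Local Open Scope ring_scope.

Definition density (T : finType) (G : sgraph T) : R :=
  (num_embeddings G)%:R / (#|T| ^_ k)%:R.

(* Graphs of order n are taken, up to isomorphism, on the vertex set 'I_n.
   Densities are nonnegative, so the default value 0 is harmless. *)
Definition max_density (n : nat) : R :=
  \big[Num.max/0]_(G : sgraph 'I_n) density G.

End Semiinducibility.

Definition is_blowup (m : nat) (B : sgraph 'I_m) (T : finType) (G : sgraph T) :
    Prop :=
  exists V : 'I_m -> {set T},
    [/\ forall i j, i != j -> [disjoint V i & V j],
        \bigcup_(i < m) V i = [set: T]%SET &
        forall i j x y, x \in V i -> y \in V j -> adj G x y = adj B i j].

Definition edit_cost (T : finType) (G G' : sgraph T) (s : {perm T}) : nat :=
  let fG := [set (s @: e)%SET | e : {set T} in edges G]%SET in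
  #|((fG :\: edges G') :|: (edges G' :\: fG))%SET|.

(* The default value of the minimum is the cost of the identity, which is
   one of the candidates. *)
Definition edit_distance (T : finType) (G G' : sgraph T) : nat :=
  \big[minn/edit_cost G G' 1%g]_(s : {perm T}) edit_cost G G' s.

(* Densities only make sense for n >= k; requiring k <= C loses nothing. *)
Definition perfectly_stable (R : realType) (k m : nat) (H : cgraph 'I_k)
    (B : sgraph 'I_m) : Prop :=
  (exists C : R, 0 < C /\ k%:R <= C /\
    forall (n : nat) (G : sgraph 'I_n), C <= n%:R ->
      exists G' : sgraph 'I_n,
        is_blowup B G' /\
        (edit_distance G G')%:R
          <= C * (max_density R H n - density R H G) * n%:R ^+ 2)%R.

Definition vtx (i : nat) : 'I_4 := inord i.

Definition star_red_edges : {set {set 'I_4}} :=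
  [set [set vtx 0; vtx 1]; [set vtx 0; vtx 2]; [set vtx 0; vtx 3]]%SET.

Definition star_blue_edges : {set {set 'I_4}} := [set [set vtx 1; vtx 3]]%SET.

Lemma vtx_inj i j : i < 4 -> j < 4 -> (vtx i == vtx j) = (i == j).
Proof. by move=> i4 j4; rewrite -val_eqE /= !inordK. Qed.

Lemma star_red_card2 : [forall e in star_red_edges, #|e| == 2].
Proof.
by apply/forall_inP => e; rewrite !inE => /orP[/orP[]|] /eqP ->;
  rewrite cards2 vtx_inj.
Qed.

Lemma star_blue_card2 : [forall e in star_blue_edges, #|e| == 2].
Proof.
by apply/forall_inP => e; rewrite !inE => /eqP ->; rewrite cards2 vtx_inj.
Qed.

Lemma star_disjoint :
  [disjoint edges (SGraph star_red_card2) & edges (SGraph star_blue_card2)].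
Proof.
rewrite disjoint_sym disjoints1 /= !inE !negb_or -!andbA.
by apply/and3P; split; apply/eqP => /setP/(_ (vtx 0)); rewrite !inE !vtx_inj.
Qed.

Definition star_H : cgraph 'I_4 := CGraph star_disjoint.

(* Main.v *)
(* An embedding consists of a centre c, an ordered pair of distinct non-adjacent
   neighbours x, y of c and a third neighbour z. If u and v are non-adjacent,
   replacing u by a clone of v or v by a clone of u does not decrease the number
   of embeddings on average, and every vertex adjacent to exactly one of u, v
   contributes a gain. Hence extremal graphs are complete multipartite, and with
   part ratios x_i the density is S2 (1 - S2) - S3 + S4, where Sk is the sum of the
   x_i^k. For a fixed largest part this is bounded by a separable sum over the
   other parts; comparing each summand with a tangent or with a line through the
   origin, according to its size, shows that the maximum is attained only by one
   part s and four parts (1 - s)/4, where 7 s^2 = s + 2.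

   For stability, consider a graph close to a complete 5-partite graph with almost
   these ratios. Flipping a wrong pair gains order n^2, up to second-order terms
   that are negligible if every vertex lies in few wrong pairs. A vertex v in many
   wrong pairs can be moved to another part with a gain of order n^3: the count is
   convex along the chain of graphs in which more and more vertices become clones
   of v, and at the far end of the chain it is at most the optimum. So the number of
   wrong pairs is at most a constant times the deficit divided by n^2, and in
   particular a near-optimal graph is never at an intermediate distance from
   5-partite. As one cloning changes the distance only by O(n), a graph that
   maximizes the count among the graphs at large distance is again complete
   multipartite, which contradicts the uniqueness of the optimal ratios. *)
Require Import Defs.
From mathcomp Require Import all_boot all_order all_algebra all_fingroup.
From mathcomp Require Import boolp ring lra zify.
Import Order.TTheory GRing.Theory Num.Theory.
Set Implicit Arguments.
Unset Strict Implicit.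
Unset Printing Implicit Defensive.
Local Open Scope ring_scope.

(** * The optimal ratios and one-variable inequalities for the largest part *)

Section Optimum.
Variable R : rcfType.
Implicit Types a y t k c b : R.

Definition big_part : R := (1 + Num.sqrt 57) / 14.
Definition small_part : R := (1 - big_part) / 4.
Definition opt_density : R := (- 171%:R * Num.sqrt 57%:R + 7879%:R) / 43904%:R.

Lemma big_part_quadratic : 7 * big_part * big_part = big_part + 2.
Proof.
have h : Num.sqrt 57 * Num.sqrt 57 = 57 :> R by rewrite -expr2 sqr_sqrtr.
by rewrite /big_part; lra.
Qed.

Lemma big_part_bounds : (610 + 7/10)/1000 <= big_part /\ big_part <= (610 + 71/100)/1000.
Proof.
have h0 : 0 <= big_part.
  by rewrite /big_part; apply: divr_ge0 => //; apply: addr_ge0 => //; exact: sqrtr_ge0.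
have h := big_part_quadratic.
by split; nra.
Qed.

(** This is the identity of [opt_density_quartic] at a = 0. *)
Lemma opt_densityE :
  64 * opt_density = 9 + big_part * big_part * (12 - 17 * big_part).
Proof.
have h := big_part_quadratic.
have -> : big_part * big_part * (12 - 17 * big_part)
          = (big_part + 2) / 7 * 12 - 17 / 7 * (big_part + 2) / 7 - 34 / 7 * big_part.
  by nra.
rewrite /opt_density /big_part.
have -> : 43904%:R = 4390%:R * 10%:R + 4%:R :> R by rewrite -natrM -natrD.
have -> : 7879%:R = 787%:R * 10%:R + 9%:R :> R by rewrite -natrM -natrD.
by field.
Qed.

Lemma opt_density_bounds : 15/100 + 5/1000/100 <= opt_density /\ opt_density <= 1501/10000.
Proof.
have h := big_part_quadratic; have [b1 b2] := big_part_bounds.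
have h3 := opt_densityE.
have e : big_part * big_part * (12 - 17 * big_part)
          = (big_part + 2) / 7 * 12 - 17 / 7 * (big_part + 2) / 7 - 34 / 7 * big_part.
  by nra.
rewrite e in h3; split; lra.
Qed.

(** The polynomial compared with [opt_density] is the density of one part a and four parts (1 -
    a)/4. The optimal s is a double root of the difference; the quotient is checked by reducing
    powers of s with 7 s^2 = s + 2. *)
Lemma opt_density_quartic a (b := 1 - a) (s := big_part) :
  64 * (opt_density - (a^+2 - a^+3 + b^+2/4*(1-2*a^+2) - b^+4/16 - b^+3/16 + b^+4/64))
  = (a - s)^+2 * (35*a^+2 + (70*s-16)*a + 12 - 17*s).
Proof.
have h := big_part_quadratic; have h3 := opt_densityE.
rewrite -/s in h h3.
have h2 : s * s = (s + 2)/7 by lra.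
have h5 : s * s * s = ((s + 2)/7 + 2 * s)/7 by rewrite {1}h2; lra.
rewrite mulrBr h3 /b.
have -> : (a - s) ^+ 2 * (35 * a ^+ 2 + (70 * s - 16) * a + 12 - 17 * s) =
  35*a^+4 - 16*a^+3 + (12 - 17*s + 32*s - 105*(s*s))*a^+2
   + (-24*s + 18 * (s*s) + 70*(s*s*s))*a + s*s*(12-17*s) by ring.
have -> : s*s*(12-17*s) = 12 * (s*s) - 17 * (s*s*s) by ring.
by rewrite h5 h2; field.
Qed.

(* The linear functions y0 of a in the next two lemmas are fitted to the best
   tangent point in partite_density_le_jensen. *)
Lemma jensen_low a (y0 := 117/1000 - 86/100 * (a - 6/10)) (b := 1 - a) :
  1/2 <= a -> a <= 58/100 ->
  a^+2 - a^+3 + b*(y0^+2 - 2*y0^+3) + (1 - 2*a^+2 - 2*y0 + 3*y0^+2)^+2/4 <= opt_density - 1/1000/1000.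
Proof.
move=> h1 h2.
(* Measured from the endpoint of the interval, the variable has constant sign and is small, which
   makes the polynomial inequality easy for [nra]. *)
rewrite {}/y0 {}/b; move: h1 h2; have [c ->] : exists c, a = c + 58/100 by exists (a - 58/100); rewrite subrK.
move=> h1 h2; have c1 : c <= 0 by lra. have c2 : -8/100 <= c by lra.
have [] := opt_density_bounds; move: opt_density => lam l1 l2.
nra.
Qed.

Lemma jensen_high a (y0 := 114/1000 - 104/100 * (a - 6/10)) (b := 1 - a) :
  616/1000 <= a -> a <= 66/100 ->
  a^+2 - a^+3 + b*(y0^+2 - 2*y0^+3) + (1 - 2*a^+2 - 2*y0 + 3*y0^+2)^+2/4 <= opt_density - 1/1000/1000.
Proof.
move=> h1 h2.
rewrite {}/y0 {}/b; move: h1 h2; have [c ->] : exists c, a = c + 616/1000 by exists (a - 616/1000); rewrite subrK.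
move=> h1 h2; have c1 : 0 <= c by lra. have c2 : c <= 44/1000 by lra.
have [] := opt_density_bounds; move: opt_density => lam l1 l2.
nra.
Qed.

(* Let a be the largest part and r the sum of squares of the other parts y.
   Replacing r^2 by 2 rho r - rho^2 in the density leaves the separable sum of
   h y = quad_coef a rho * y^2 - y^3 + y^4; slope and offset describe the tangent
   of h at t. In the next lemmas rho and t are linear fits, in a, of the optimal
   choices, and 4/100 separates the parts compared with the tangent from those
   compared with the line through 0. *)
Definition quad_coef a rho : R := 1 - 2*a^+2 - 2*rho.
Definition slope b t : R := 2*b*t - 3*t^+2 + 4*t^+3.
Definition offset b t : R := t^+2 * (2*t - 3*t^+2 - b).

(** The tangent at t minus h y is (y - t)^2 times y + 2 t - y^2 - 2 t y - 3 t^2 - b, the negated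
    second divided difference of h at t, t, y. *)
Lemma tangent_bound b t q y : 
  q <= y + 2*t - y^+2 - 2*t*y - 3*t^+2 - b ->
  b*y^+2 - y^+3 + y^+4 <= slope b t * y + offset b t - q*(y-t)^+2.
Proof.
move=> h; rewrite /slope /offset.
have := mulr_ge0 (sqr_ge0 (y - t)) (_ : 0 <= y + 2*t - y^+2 - 2*t*y - 3*t^+2 - b - q).
rewrite subr_ge0 => /(_ h); lra.
Qed.

(** For at most three parts above 4/100 besides the largest: the offset is nonnegative, so three
    such parts are the worst case. The clauses give the tangent bound above 4/100, the bound by a
    line through 0 below it, the sign of the offset and the resulting total. *)
Lemma three_parts a (rho := 5/100 - 6/10*(a - 6/10)) (t := 12/100 - (a - 6/10)) (b := quad_coef a rho) :
  58/100 <= a -> a <= 616/1000 ->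
  [/\ forall y, 4/100 <= y -> y <= 1 - a -> 0 <= y + 2*t - y^+2 - 2*t*y - 3*t^+2 - b,
      forall y, 0 <= y -> y < 4/100 -> b*y^+2 - y^+3 + y^+4 <= slope b t * y,
      0 <= offset b t &
      a^+2 - a^+3 + rho^+2 + slope b t * (1 - a) + 3 * offset b t <= opt_density - 1/1000/1000].
Proof.
move=> h1 h2.
rewrite {}/b {}/t {}/rho /quad_coef /offset /slope; move: h1 h2.
have [c ->] : exists c, a = c + 6/10 by exists (a - 6/10); rewrite subrK.
rewrite !addrK => h1 h2.
have c1 : -2/100 <= c by lra. have c2 : c <= 16/1000 by lra.
split.
- move=> y y1 y2; nra.
- move=> y y1 y2.
  (* This is the claim divided by y. *)
  suff : (1 - 2 * (c + 6 / 10) ^+ 2 - 2 * (5 / 100 - 6 / 10 * c)) * y - y ^+ 2 + y ^+ 3 <= 2 * (1 - 2 * (c + 6 / 10) ^+ 2 - 2 * (5 / 100 - 6 / 10 * c)) * (12 / 100 - c) - 3 * (12 / 100 - c) ^+ 2 + 4 * (12 / 100 - c) ^+ 3.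
    by move=> /(ler_wpM2l y1); lra.
  nra.
- apply: mulr_ge0; [exact: sqr_ge0 | nra].
- have [] := opt_density_bounds; move: opt_density => lam l1 l2. nra.
Qed.


End Optimum.

Section FourParts.
Variable R : rcfType.
Implicit Types a y t k c b : R.
Local Notation opt_density := (opt_density R).
Local Notation big_part := (big_part R).
Local Notation small_part := (small_part R).

(** For at least four parts above 4/100: the offset is now nonpositive, so exactly four such parts
    are the worst case. *)
Lemma four_parts_low a (rho := 4/100 - 7/10*(a - 6/10)) (t := 1/10 - 9/10*(a - 6/10)) (b := quad_coef a rho) :
  58/100 <= a -> a <= 6/10 ->
  [/\ forall y, 4/100 <= y -> y <= 1 - a -> 0 <= y + 2*t - y^+2 - 2*t*y - 3*t^+2 - b,
      forall y, 0 <= y -> y < 4/100 -> b*y^+2 - y^+3 + y^+4 <= slope b t * y,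
      offset b t <= 0 &
      a^+2 - a^+3 + rho^+2 + slope b t * (1 - a) + 4 * offset b t <= opt_density - 1/1000/1000].
Proof.
rewrite {}/b {}/t {}/rho /quad_coef /offset /slope.
have [c ->] : exists c, a = c + 6/10 by exists (a - 6/10); rewrite subrK.
rewrite !addrK => h1 h2.
have c1 : -2/100 <= c by lra. have c2 : c <= 0 by lra.
split.
- move=> y y1 y2; nra.
- move=> y y1 y2.
  suff : (1 - 2 * (c + 6 / 10) ^+ 2 - 2 * (4 / 100 - 7 / 10 * c)) * y - y ^+ 2 + y ^+ 3 <= 2 * (1 - 2 * (c + 6 / 10) ^+ 2 - 2 * (4 / 100 - 7 / 10 * c)) * (1 / 10 - 9/10*c) - 3 * (1 / 10 - 9/10*c) ^+ 2 + 4 * (1 / 10 - 9/10*c) ^+ 3.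
    by move=> /(ler_wpM2l y1); lra.
  nra.
- rewrite mulr_ge0_le0 ?sqr_ge0 //; nra.
- have [] := opt_density_bounds R; move: opt_density => lam l1 l2. nra.
Qed.

(* Here t and rho are the exact values for four equal small parts. *)
Lemma four_parts a (rho := (1 - a)^+2/4) (t := (1 - a)/4) (b := quad_coef a rho) :
  6/10 <= a -> a <= 616/1000 ->
  [/\ forall y, 4/100 <= y -> y <= 1 - a -> 3/100/100 <= y + 2*t - y^+2 - 2*t*y - 3*t^+2 - b,
      forall y, 0 <= y -> y < 4/100 -> b*y^+2 - y^+3 + y^+4 <= (slope b t - 1/1000) * y,
      offset b t <= - (1/1000/100) &
      a^+2 - a^+3 + rho^+2 + slope b t * (1 - a) + 4 * offset b t <= opt_density - (a - big_part)^+2 / 8].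
Proof.
move=> h1 h2.
have hc : exists c, a = c + 6/10 by exists (a - 6/10); rewrite subrK.
split.
- move: hc h1 h2; rewrite {}/b {}/t {}/rho /quad_coef => -[c -> h1 h2].
  have c1 : 0 <= c by lra. have c2 : c <= 16/1000 by lra.
  move=> y y1 y2; nra.
- move: hc h1 h2; rewrite {}/b {}/t {}/rho /quad_coef /slope => -[c -> h1 h2].
  have c1 : 0 <= c by lra. have c2 : c <= 16/1000 by lra.
  move=> y y1 y2.
  set b := 1 - 2 * _ - _; set t := (_ - _)/_.
  suff : b * y - y ^+ 2 + y ^+ 3 <= 2*b*t - 3*t^+2 + 4*t^+3 - 1/1000.
    by move=> /(ler_wpM2l y1); lra.
  rewrite {}/b {}/t; nra.
- move: hc h1 h2; rewrite {}/b {}/t {}/rho /quad_coef /offset => -[c -> h1 h2].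
  have c1 : 0 <= c by lra. have c2 : c <= 16/1000 by lra.
  set t := (_ - _)/_.
  have t1 : 95/1000 <= t by rewrite /t; lra.
  have : 2*t - 3*t^+2 - (1 - 2 * (c+6/10)^+2 - 2 * ((1 - (c+6/10))^+2/4)) <= -2/1000.
    by rewrite /t; nra.
  move: (_ - _ : R) => z hz; nra.
- move: (opt_density_quartic a) (big_part_bounds R) => /=.
  rewrite {}/b {}/t {}/rho /quad_coef /offset /slope.
  (* The last factor in [opt_density_quartic] is at least 8 here; divided by 64 this yields the
     coefficient 1/8. *)
  have q (s : R) : (610 + 7/10)/1000 <= s /\ s <= (610+71/100)/1000 ->
    8 * (a - s)^+2 <= (a - s)^+2 * (35*a^+2 + (70*s-16)*a + 12 - 17*s).
    move=> [s1 s2]; rewrite mulrC; apply: ler_wpM2l; first exact: sqr_ge0.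
    nra.
  move: opt_density big_part => lam s e /q {}q.
  lra.
Qed.

End FourParts.

Lemma norm_le_sqr (R : realDomainType) (u v : R) :
  0 <= v -> u ^+ 2 <= v ^+ 2 -> `|u| <= v.
Proof.
by move=> v0; rewrite -[u ^+ 2]real_normK ?num_real // ler_pXn2r // nnegrE.
Qed.

(** * Maximum of the multipartite density and its stability *)

Section PartiteDensity.
Variables (R : rcfType) (I : finType) (x : I -> R).

(** For ratios of sum 1 this is the sum of x_i (1 - x_i) (S2 - x_i^2): the centre lies in part i,
    the third leaf outside it, and the non-adjacent pair in one common other part. *)
Definition partite_density : R :=
  (\sum_i x i ^+ 2) * (1 - \sum_i x i ^+ 2) - \sum_i x i ^+ 3 + \sum_i x i ^+ 4.

Hypothesis x_ge0 : forall i, 0 <= x i.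
Hypothesis sum_x : \sum_i x i = 1.

Lemma sum_rest i0 : \sum_(i | i != i0) x i = 1 - x i0.
Proof. by rewrite -sum_x [in RHS](bigD1 i0) //= [x i0 + _]addrC addrK. Qed.

Lemma part_le_rest i0 i : i != i0 -> x i <= 1 - x i0.
Proof.
move=> h; rewrite -(sum_rest i0) (bigD1 i) //= lerDl.
by apply: sumr_ge0.
Qed.

Lemma partite_density_rest i0 (a := x i0) (r := \sum_(i | i != i0) x i ^+ 2) :
  partite_density =
  a^+2 - a^+3 + r * (1 - 2 * a^+2) - r^+2 - \sum_(i | i != i0) (x i ^+ 3 - x i ^+ 4).
Proof.
rewrite /partite_density sumrB !(bigD1 i0 (P := predT)) //= -/a -/r.
by move: (\sum_(_ | _) _ ^+ 3) (\sum_(_ | _) _ ^+ 4) => u v; ring.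
Qed.

(** The only non-separable term, - r^2, is bounded by rho^2 - 2 rho r since (r - rho)^2 is
    nonnegative. *)
Lemma partite_density_le_quad i0 rho (a := x i0) :
  partite_density <= a^+2 - a^+3 + rho^+2
    + \sum_(i | i != i0) (quad_coef a rho * x i ^+ 2 - x i ^+ 3 + x i ^+ 4).
Proof.
rewrite (partite_density_rest i0) -/a.
have -> : \sum_(i | i != i0) (quad_coef a rho * x i ^+ 2 - x i ^+ 3 + x i ^+ 4)
  = quad_coef a rho * (\sum_(i | i != i0) x i ^+ 2) - \sum_(i | i != i0) (x i ^+ 3 - x i ^+ 4).
  by rewrite mulr_sumr -sumrB; apply: eq_bigr => i _; ring.
set r := \sum_(i | _) x i ^+ 2; set u := \sum_(i | _) (_ - _); rewrite /quad_coef.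
have := sqr_ge0 (r - rho); lra.
Qed.

(** For each other part, x (x - y0)^2 (1 - x - 2 y0) >= 0 bounds x^3 - x^4 below by a combination of
    x^2 and x. What remains is quadratic in r, and completing the square removes r. *)
Lemma partite_density_le_jensen i0 y0 (a := x i0) :
  (forall i, i != i0 -> x i <= 1 - 2 * y0) ->
  partite_density <= a^+2 - a^+3 + (1 - a)*(y0^+2 - 2*y0^+3)
     + (1 - 2*a^+2 - 2*y0 + 3*y0^+2)^+2/4.
Proof.
move=> h; rewrite (partite_density_rest i0) -/a.
set r := \sum_(i | _) _ ^+ 2; set u := \sum_(i | _) _.
have : (2*y0 - 3*y0^+2) * r - (y0^+2 - 2*y0^+3) * (1 - a) <= u.
  rewrite -(sum_rest i0) /r /u !mulr_sumr -sumrB; apply: ler_sum => i /h hi.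
  have := mulr_ge0 (mulr_ge0 (x_ge0 i) (sqr_ge0 (x i - y0))) (_ : 0 <= 1 - x i - 2*y0).
  have -> : 0 <= 1 - x i - 2 * y0 by lra.
  move=> /(_ isT); lra.
have := sqr_ge0 (r - (1 - 2*a^+2 - 2*y0 + 3*y0^+2)/2); lra.
Qed.

(** Parts of ratio at least [kappa] are bounded by a line of slope [m] and offset [w], minus a
    quadratic penalty for their distance from t. Smaller parts are bounded by a line through 0 of
    slope at most [m], so only the parts in [P] contribute an offset. *)
Lemma partite_density_le_parts i0 kappa rho m w t q d (a := x i0)
    (P := [set i | (i != i0) && (kappa <= x i)]) :
  (forall y, kappa <= y -> y <= 1 - a -> 
    quad_coef a rho * y ^+ 2 - y ^+ 3 + y ^+ 4 <= m * y + w - q * (y - t) ^+ 2) ->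
  (forall y, 0 <= y -> y < kappa ->
    quad_coef a rho * y ^+ 2 - y ^+ 3 + y ^+ 4 <= (m - d) * y) ->
  0 <= d ->
  partite_density <= a^+2 - a^+3 + rho^+2 + m * (1 - a) + #|P|%:R * w
    - q * \sum_(i in P) (x i - t)^+2.
Proof.
move=> hP hS d0; apply: le_trans (partite_density_le_quad i0 rho) _.
rewrite -/a -!addrA !lerD2l -(sum_rest i0) (bigID (mem P)) /=.
rewrite (bigID (mem P) (fun i => i != i0) x) /=.
have eP i : (i != i0) && (i \in P) = (i \in P).
  by rewrite inE; case: (i != i0).
rewrite !(eq_bigl _ _ eP).
have h1 : \sum_(i in P) (quad_coef a rho * x i ^+ 2 - x i ^+ 3 + x i ^+ 4) <=
   \sum_(i in P) (m * x i + w - q * (x i - t)^+2).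
  by apply: ler_sum => i; rewrite inE => /andP[h1 h2]; apply: hP => //; exact: part_le_rest.
have h2 : \sum_(i | (i != i0) && (i \notin P)) (quad_coef a rho * x i ^+ 2 - x i ^+ 3 + x i ^+ 4) <=
  \sum_(i | (i != i0) && (i \notin P)) (m * x i).
  apply: ler_sum => i /andP[h]; rewrite inE h /= -ltNge => h3.
  apply: le_trans (hS _ _ h3) _ => //; rewrite mulrBl gerBl; exact: mulr_ge0.
apply: le_trans (lerD h1 h2) _.
rewrite sumrB big_split /= -!mulr_sumr sumr_const -[w *+ _]mulr_natl.
by move: (\sum_(i in P) x i) => A; move: (\sum_(i | _ && _) _) => B; lra.
Qed.

(** A case split on the largest ratio a. The density misses the optimum by a fixed amount unless a
    lies in [6/10, 616/1000] and at least four other parts reach 4/100; then the penalties measure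
    the deviation from the optimal ratios. *)
Lemma partite_density_gap :
  partite_density <= opt_density R - 1/1000/1000 \/
  exists i0 (P : {set I}), [/\ i0 \notin P, (4 <= #|P|)%N &
   partite_density <= opt_density R - (x i0 - big_part R)^+2/8
     - 3/100/100 * \sum_(i in P) (x i - (1 - x i0)/4)^+2
     - 1/1000/100 * (#|P|%:R - 4)].
Proof.
have [i1 _] : exists i1 : I, i1 \in predT.
  case: (pickP (@predT I)) => [i _|h]; first by exists i.
  by move: sum_x; rewrite big_pred0 // => /eqP; rewrite eq_sym oner_eq0.
case: (@arg_maxP _ _ _ i1 predT x isT) => i0 _ hmax.
set a := x i0.
have a0 : 0 <= a := x_ge0 i0.
have x_le i : x i <= a by exact: hmax.
have rest_b i : i != i0 -> x i <= 1 - a := @part_le_rest i0 i.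
have [lb _] := opt_density_bounds R.
have [a52|a52] := lerP a (52/100).
  left.
  (* All parts are at most 52/100, so the inequality of [partite_density_le_jensen] with y0 = 24/100
     holds for every part, the largest included. Below, 3464/10000 is the vertex of the resulting
     parabola in S2. *)
  have : 0 <= \sum_i x i * ((x i - 24/100)^+2 * (1 - x i - 48/100)).
    apply: sumr_ge0 => i _; apply: mulr_ge0 => //; apply: mulr_ge0; first exact: sqr_ge0.
    have := x_le i; lra.
  have -> : \sum_i x i * ((x i - 24/100)^+2 * (1 - x i - 48/100))
    = \sum_i x i ^+ 3 - \sum_i x i ^+ 4 - (48/100 - 3*(24/100)^+2) * \sum_i x i ^+ 2
     + ((24/100)^+2 - 2 * (24/100)^+3) * \sum_i x i.
    rewrite !mulr_sumr -!sumrB -big_split /=; apply: eq_bigr => i _; ring.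
  rewrite sum_x /partite_density.
  move: (opt_density _) lb (\sum_i _ ^+ 2) (\sum_i _ ^+ 3) (\sum_i _ ^+ 4) => lam lb s u v.
  have := sqr_ge0 (s - 3464/10/1000); lra.
have [a58|a58] := lerP a (58/100).
  left; have a50 : 1/2 <= a by lra.
  apply: le_trans (jensen_low a50 a58).
  apply: partite_density_le_jensen => i /rest_b; rewrite -/a; lra.
have [a66|a66] := lerP (66/100) a.
  left; apply: le_trans (partite_density_le_quad i0 (2/100)) _; rewrite -/a.
  have h : \sum_(i | i != i0) (quad_coef a (2/100) * x i ^+ 2 - x i ^+ 3 + x i ^+ 4)
     <= \sum_(i | i != i0) 4/1000 * x i.
    apply: ler_sum => i /rest_b h.
    have : quad_coef a (2/100) * x i - x i ^+2 + x i ^+ 3 <= 4/1000.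
      have := x_ge0 i; rewrite /quad_coef; move: (x i) h => y h y0.
      have a1 : 66/100 * (66/100) <= a^+2 by nra.
      have := ler_wpM2l y0 a1; have : 0 <= y^+2 * (34/100 - y) by nra.
      nra.
    move=> /(ler_wpM2l (x_ge0 i)); lra.
  rewrite -mulr_sumr sum_rest -/a in h.
  (* The maximum of a^2 - a^3 for nonnegative a is 4/27, at a = 2/3. *)
  have : a^+2 - a^+3 <= 1482/10/1000.
    have := mulr_ge0 (sqr_ge0 (a - 2/3)) (_ : 0 <= a + 1/3); have -> : 0 <= a + 1/3 by lra.
    by move=> /(_ isT); lra.
  move: (opt_density _) lb h; move: (\sum_(i | _) _) => S lam lb h h'; lra.
have [a616|a616] := lerP (616/1000) a.
  left; apply: le_trans (jensen_high a616 (ltW a66)).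
  apply: partite_density_le_jensen => i /rest_b; rewrite -/a; lra.
set P := [set i | (i != i0) && (4/100 <= x i)].
have [P4|P4] := leqP 4 #|P|; last first.
  left; have [h1 h2 h3 h4] := three_parts (ltW a58) (ltW a616).
  apply: le_trans h4.
  apply: le_trans (@partite_density_le_parts i0 (4/100) _ _ _ _ 0 0 _ _ _) _.
  - by move=> y y1 y2; apply: tangent_bound; exact: h1.
  - by move=> y y1 y2; rewrite subr0; exact: h2.
  - exact: lexx.
  rewrite mul0r subr0 -/P lerD2l; apply: ler_wpM2r => //.
  by rewrite ler_nat.
have [a60|a60] := lerP (6/10) a; last first.
  left; have [h1 h2 h3 h4] := four_parts_low (ltW a58) (ltW a60).
  apply: le_trans h4.
  apply: le_trans (@partite_density_le_parts i0 (4/100) _ _ _ _ 0 0 _ _ _) _.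
  - by move=> y y1 y2; apply: tangent_bound; exact: h1.
  - by move=> y y1 y2; rewrite subr0; exact: h2.
  - exact: lexx.
  rewrite mul0r subr0 -/P lerD2l; apply: ler_wnM2r => //.
  by rewrite ler_nat.
right; exists i0, P; split => //; first by rewrite inE eqxx.
have [h1 h2 h3 h4] := four_parts a60 (ltW a616).
apply: le_trans (@partite_density_le_parts i0 (4/100) _ _ _ _ (3/100/100) (1/1000) _ _ _) _.
- by move=> y y1 y2; apply: tangent_bound; exact: h1.
- exact: h2.
- lra.
rewrite -/P -/a; move: h3 h4; set w := offset _ _.
have : (4:R) <= #|P|%:R by rewrite (ler_nat _ 4).
move: (#|P|%:R : R) (opt_density R) (\sum_(i in P) _) => m lam S m4 w0 hw.
have := mulr_ge0 (_ : 0 <= m - 4) (_ : 0 <= - (1/1000/100) - w).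
rewrite !subr_ge0 => /(_ m4 w0); lra.
Qed.

Lemma partite_density_le : partite_density <= opt_density R.
Proof.
have [h|[i0 [P [_ P4 h]]]] := partite_density_gap.
  by apply: le_trans h _; rewrite gerBl; lra.
apply: le_trans h _.
have h1 := sqr_ge0 (x i0 - big_part R).
have h2 : 0 <= \sum_(i in P) (x i - (1 - x i0)/4)^+2.
  by apply: sumr_ge0 => i _; exact: sqr_ge0.
have h3 : (4:R) <= #|P|%:R by rewrite (ler_nat _ 4).
move: (opt_density R) => lam; lra.
Qed.

(** A deficit of at most eta^2/10^8 excludes the fixed gap of 1/10^6. As every part of [P] beyond
    the fourth costs 1/10^5, [P] has exactly four elements, and the two quadratic penalties bound
    the deviations. *)
Lemma partite_density_stable eta : 0 < eta -> eta <= 1 ->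
  opt_density R - eta^+2/1000/1000/100 <= partite_density ->
  exists i0 (P : {set I}), [/\ i0 \notin P, #|P| = 4%N, `|x i0 - big_part R| <= eta
    & forall i, i \in P -> `|x i - small_part R| <= eta].
Proof.
move=> e0 e1 he.
have e2 : eta^+2 <= 1 by nra.
have [h|[i0 [P [hi0 P4 h]]]] := partite_density_gap.
  move: (opt_density R) he h => lam he h; exfalso; lra.
exists i0, P.
have h1 := sqr_ge0 (x i0 - big_part R).
have h2 i : i \in P -> (x i - (1 - x i0)/4)^+2 <= \sum_(i in P) (x i - (1 - x i0)/4)^+2.
  move=> hi; rewrite (bigD1 i) //= lerDl.
  by apply: sumr_ge0 => j _; exact: sqr_ge0.
have h2' : 0 <= \sum_(i in P) (x i - (1 - x i0)/4)^+2.
  by apply: sumr_ge0 => i _; exact: sqr_ge0.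
have h3 : (4:R) <= #|P|%:R by rewrite (ler_nat _ 4).
have h4 : `|x i0 - big_part R| <= eta/10.
  move: (opt_density R) h he => lam h he.
  by apply: norm_le_sqr; lra.
split => //.
- apply/eqP; rewrite eqn_leq P4 andbT leqNgt; apply/negP => P5.
  have : (5:R) <= #|P|%:R by rewrite (ler_nat _ 5).
  move: (opt_density R) h he => lam h he; lra.
- lra.
- move=> i /h2 hi.
  have h5 : `|x i - (1 - x i0)/4| <= eta/2.
    move: (opt_density R) h he => lam h he.
    by apply: norm_le_sqr; lra.
  move: h4 h5; rewrite /small_part !ler_norml => /andP[u1 u2] /andP[u3 u4].
  by apply/andP; split; lra.
Qed.

End PartiteDensity.

(** * Symmetrization *)

Section Counting.
Variables (R : rcfType) (T : finType).
Implicit Types (e f : rel T) (c u v x y z : T).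

Definition edge_ind e x y : R := (e x y)%:R.
Definition deg e c : R := \sum_x edge_ind e c x.
Definition nonadj_pairs e c : R :=
  \sum_x \sum_y edge_ind e c x * edge_ind e c y * (1 - edge_ind e x y).
(* The number of embeddings: c is the centre, deg e c - 2 counts the third leaf,
   and deg is subtracted from nonadj_pairs to remove the pairs with x = y. *)
Definition star_count e : R :=
  \sum_c (deg e c - 2) * (nonadj_pairs e c - deg e c).
Definition deg_sq e : R := \sum_c deg e c ^+ 2.

Definition redirect u v x := if x == u then v else x.
(** Here u becomes a twin of v. As a pullback along [redirect], the clone turns sums over its
    vertices into sums for [e] with a single term exchanged. *)
Definition clone e u v : rel T := relpre (redirect u v) e.

Lemma sum_redirect u v (F : T -> R) :
  \sum_x F (redirect u v x) = \sum_x F x + F v - F u.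
Proof.
rewrite (bigD1 u) //= [\sum_x F x](bigD1 u) //= /redirect eqxx.
rewrite (eq_bigr F); last by move=> x /negPf ->.
by rewrite [F u + _]addrC addrAC addrK addrC.
Qed.

Lemma ind_ge0 e x y : 0 <= edge_ind e x y. Proof. exact: ler0n. Qed.
Lemma ind_le1 e x y : edge_ind e x y <= 1.
Proof. by rewrite /edge_ind; case: (e x y). Qed.

Lemma deg_ge0 e c : 0 <= deg e c.
Proof. by apply: sumr_ge0 => x _; exact: ind_ge0. Qed.

Lemma deg_le e c : deg e c <= #|T|%:R.
Proof.
rewrite /deg -sum1_card natr_sum; apply: ler_sum => x _; exact: ind_le1.
Qed.

Section Clone.
Variables (e : rel T) (u v : T).
Hypotheses (e_sym : symmetric e) (e_irr : irreflexive e) (uv : ~~ e u v).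

Let indC x y : edge_ind e x y = edge_ind e y x. Proof. by rewrite /edge_ind e_sym. Qed.
Let ind_xx x : edge_ind e x x = 0. Proof. by rewrite /edge_ind e_irr. Qed.

Let nonnbr w c := \sum_y edge_ind e c y * (1 - edge_ind e w y).

Let deg_clone a b c :
  deg (clone e a b) c = let c' := redirect a b c in deg e c' + edge_ind e c' b - edge_ind e c' a.
Proof. exact: (sum_redirect a b (edge_ind e (redirect a b c))). Qed.

Let nonadj_clone a b c : ~~ e a b ->
  nonadj_pairs (clone e a b) c = let c' := redirect a b c in
  nonadj_pairs e c' + 2 * (edge_ind e c' b * nonnbr b c' - edge_ind e c' a * nonnbr a c')
  + (edge_ind e c' a - edge_ind e c' b) ^+ 2.
Proof.
move=> ab /=; set c' := redirect a b c.
have iab : edge_ind e a b = 0 by rewrite /edge_ind (negPf ab).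
pose F x y := edge_ind e c' x * edge_ind e c' y * (1 - edge_ind e x y).
have FC x y : F x y = F y x by rewrite /F [edge_ind e x y]indC; ring.
have -> : nonadj_pairs e c' = \sum_x \sum_y F x y by [].
pose G x := \sum_y F x y + F x b - F x a.
rewrite /nonadj_pairs (eq_bigr (fun x => G (redirect a b x))); last first.
  move=> x _; exact: (sum_redirect a b (F (redirect a b x))).
rewrite sum_redirect /G sumrB big_split /=.
have FE w : \sum_y F w y = edge_ind e c' w * nonnbr w c'.
  by rewrite /nonnbr mulr_sumr; apply: eq_bigr => y _; rewrite /F; ring.
have FE' w : \sum_y F y w = edge_ind e c' w * nonnbr w c'.
  by rewrite -FE; apply: eq_bigr => y _; rewrite FC.
rewrite !FE' !FE (FC b a); move: (\sum_x \sum_y _) => S.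
by rewrite /F iab !ind_xx; ring.
Qed.

Let term_clone a b c : ~~ e a b ->
  (deg (clone e a b) c - 2) * (nonadj_pairs (clone e a b) c - deg (clone e a b) c)
  = let c' := redirect a b c in
    (deg e c' + edge_ind e c' b - edge_ind e c' a - 2) *
    (nonadj_pairs e c' + 2 * (edge_ind e c' b * nonnbr b c' - edge_ind e c' a * nonnbr a c')
      + (edge_ind e c' a - edge_ind e c' b) ^+ 2 - (deg e c' + edge_ind e c' b - edge_ind e c' a)).
Proof. by move=> ab; rewrite nonadj_clone // deg_clone. Qed.

(** The degree of c changes by opposite amounts in the two clonings, by 1 in absolute value exactly
    if c is adjacent to one of u, v; then (d + 1)^2 + (d - 1)^2 = 2 d^2 + 2. The terms of the
    exchanged vertices cancel. *)
Lemma deg_sq_clone :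
  deg_sq (clone e u v) + deg_sq (clone e v u)
  = 2 * deg_sq e + 2 * \sum_c (e c u != e c v)%:R.
Proof.
have vu : ~~ e v u by rewrite e_sym.
have h a b : ~~ e a b -> deg_sq (clone e a b) =
  \sum_c (deg e c + edge_ind e c b - edge_ind e c a)^+2 + deg e b ^+ 2 - deg e a ^+ 2.
  move=> ab; pose G c := (deg e c + edge_ind e c b - edge_ind e c a)^+2.
  rewrite /deg_sq (eq_bigr (fun c => G (redirect a b c))); last first.
    by move=> c _; rewrite deg_clone.
  have iab : edge_ind e a b = 0 by rewrite /edge_ind (negPf ab).
  by rewrite sum_redirect /G !ind_xx iab [edge_ind e b a]indC iab; ring.
rewrite !h //.
have -> : forall A B C D : R, A + C - D + (B + D - C) = A + B by move=> *; ring.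
rewrite /deg_sq !mulr_sumr -!big_split /=; apply: eq_bigr => c _.
by rewrite /edge_ind; case: (e c u); case: (e c v); rewrite /=; ring.
Qed.

(* For a vertex c adjacent to u but not to v, the gain is
   4 nu + 2 (d_c - 1) where nu counts the non-neighbours of u in N(c) \ {u, v}. *)
Lemma star_count_clone :
  2 * star_count e + \sum_c (e c u != e c v)%:R * (2 * deg e c - 2)
   <= star_count (clone e u v) + star_count (clone e v u).
Proof.
have vu : ~~ e v u by rewrite e_sym.
have h a b : ~~ e a b -> star_count (clone e a b) =
  \sum_c (deg e c + edge_ind e c b - edge_ind e c a - 2) *
    (nonadj_pairs e c + 2 * (edge_ind e c b * nonnbr b c - edge_ind e c a * nonnbr a c)
      + (edge_ind e c a - edge_ind e c b) ^+ 2 - (deg e c + edge_ind e c b - edge_ind e c a))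
  + (deg e b - 2) * (nonadj_pairs e b - deg e b)
  - (deg e a - 2) * (nonadj_pairs e a - deg e a).
  move=> ab; pose G c := (deg e c + edge_ind e c b - edge_ind e c a - 2) *
    (nonadj_pairs e c + 2 * (edge_ind e c b * nonnbr b c - edge_ind e c a * nonnbr a c)
      + (edge_ind e c a - edge_ind e c b) ^+ 2 - (deg e c + edge_ind e c b - edge_ind e c a)).
  rewrite /star_count (eq_bigr (fun c => G (redirect a b c))); last first.
    by move=> c _; rewrite term_clone.
  have iab : edge_ind e a b = 0 by rewrite /edge_ind (negPf ab).
  by rewrite sum_redirect /G !ind_xx iab [edge_ind e b a]indC iab; ring.
rewrite !h //.
have -> : forall A B C D : R, A + C - D + (B + D - C) = A + B by move=> *; ring.
rewrite /star_count mulr_sumr -!big_split /=; apply: ler_sum => c _.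
(* The vertex w, being its own non-neighbour, is counted in [nonnbr w c]. *)
have nonnbr_ge1 w : edge_ind e c w = 1 -> 1 <= nonnbr w c.
  move=> cw; rewrite /nonnbr (bigD1 w) //= ind_xx cw subr0 mulr1 lerDl.
  apply: sumr_ge0 => y _; rewrite mulr_ge0 ?ind_ge0 // subr_ge0; exact: ind_le1.
have := nonnbr_ge1 u; have := nonnbr_ge1 v; rewrite /edge_ind.
move: (nonnbr u c) (nonnbr v c) (deg e c) (nonadj_pairs e c) => al be d q.
case: (e c u); case: (e c v); rewrite /= => h1 h2.
- lra.
- have := h2 erefl; lra.
- have := h1 erefl; lra.
- lra.
Qed.
End Clone.

Lemma clone_sym e u v : symmetric e -> symmetric (clone e u v).
Proof. by move=> h x y; rewrite /clone /= h. Qed.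
Lemma clone_irr e u v : irreflexive e -> irreflexive (clone e u v).
Proof. by move=> h x; rewrite /clone /= h. Qed.

End Counting.

(** * Perturbation of the star count *)

Section UnitInterval.
Variable R : realDomainType.
Implicit Types a b c m : R.

Lemma mul_lipschitz a b a' b' : 0 <= a <= 1 -> 0 <= b' <= 1 ->
  `|a' * b' - a * b| <= `|a' - a| + `|b' - b|.
Proof.
move=> /andP[a0 a1] /andP[b0 b1].
have -> : a' * b' - a * b = (a' - a) * b' + a * (b' - b) by ring.
apply: le_trans (ler_normD _ _) _; rewrite !normrM (ger0_norm a0) (ger0_norm b0).
by apply: lerD; [apply: ler_piMr | apply: ler_piMl].
Qed.

Lemma mul01 a b : 0 <= a <= 1 -> 0 <= b <= 1 -> 0 <= a * b <= 1.
Proof.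
by move=> /andP[a0 a1] /andP[b0 b1]; rewrite mulr_ge0 //= mulr_ile1.
Qed.

Lemma mul4_lipschitz a b c m a' b' c' m' :
  0 <= a <= 1 -> 0 <= b <= 1 -> 0 <= c <= 1 -> 0 <= m <= 1 ->
  0 <= a' <= 1 -> 0 <= b' <= 1 -> 0 <= c' <= 1 -> 0 <= m' <= 1 ->
  `|a' * b' * c' * m' - a * b * c * m| <= `|a' - a| + `|b' - b| + `|c' - c| + `|m' - m|.
Proof.
move=> a1 b1 c1 m1 a1' b1' c1' m1'.
apply: le_trans (mul_lipschitz _ _ (mul01 (mul01 a1 b1) c1) m1') _; rewrite lerD2r.
apply: le_trans (mul_lipschitz _ _ (mul01 a1 b1) c1') _; rewrite lerD2r.
exact: mul_lipschitz.
Qed.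

Lemma mul4_taylor a b c m a' b' c' m' 
  (A := a' - a) (B := b' - b) (C := c' - c) (M := m' - m) :
  0 <= a <= 1 -> 0 <= b <= 1 -> 0 <= c <= 1 -> 0 <= m <= 1 ->
  0 <= a' <= 1 -> 0 <= b' <= 1 -> 0 <= c' <= 1 -> 0 <= m' <= 1 ->
  `|a' * b' * c' * m' - a * b * c * m
     - (A * b * c * m + a * B * c * m + a * b * C * m + a * b * c * M)|
  <= `|A| * `|B| + `|A| * `|C| + `|A| * `|M| + `|B| * `|C| + `|B| * `|M| + `|C| * `|M|.
Proof.
move=> a1 b1 c1 m1 a1' b1' c1' m1'.
(* Telescoping from the left; beyond the linear terms every summand contains two increments. *)
have -> : a' * b' * c' * m' - a * b * c * m
     - (A * b * c * m + a * B * c * m + a * b * C * m + a * b * c * M) =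
  A * (b' * c' * m' - b * c * m) + a * B * (c' * m' - c * m) + a * b * (C * M).
  by rewrite /A /B /C /M; ring.
apply: le_trans (ler_normD _ _) _.
have h3 : `|a * b * (C * M)| <= `|C| * `|M|.
  have /andP[h0 h1] := mul01 a1 b1.
  by rewrite normrM (ger0_norm h0) normrM ler_piMl // mulr_ge0.
have h2 : `|a * B * (c' * m' - c * m)| <= `|B| * `|C| + `|B| * `|M|.
  have /andP[h0 h1] := a1.
  rewrite -mulrA normrM (ger0_norm h0) normrM -mulrDr.
  apply: le_trans (ler_piMl _ h1) _; first by rewrite mulr_ge0.
  by apply: ler_wpM2l => //; exact: mul_lipschitz.
have h1 : `|A * (b' * c' * m' - b * c * m)| <= `|A| * `|B| + `|A| * `|C| + `|A| * `|M|.
  rewrite normrM -!mulrDr; apply: ler_wpM2l => //.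
  apply: le_trans (mul_lipschitz _ _ (mul01 b1 c1) m1') _; rewrite lerD2r.
  exact: mul_lipschitz.
apply: le_trans (lerD (ler_normD _ _) h3) _.
by move: h1 h2; move: (`|A * _|) (`|a * B * _|) => u v; lra.
Qed.
End UnitInterval.

Section Perturbation.
Variables (R : rcfType) (T : finType).
Implicit Types (e f : rel T) (c u v x y z : T).
Local Notation n := (#|T|%:R : R).
Local Notation ind := (@edge_ind R T).

(** Ordered pairs are counted, so for graphs each wrong pair counts twice. *)
Definition dist e f : nat := \sum_x \sum_y (e x y != f x y).
Definition edge_diff e f x y : R := (e x y != f x y)%:R.

Lemma distE e f : (dist e f)%:R = \sum_x \sum_y edge_diff e f x y.
Proof. by rewrite natr_sum; apply: eq_bigr => x _; rewrite natr_sum. Qed.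

Lemma diff_ge0 e f x y : 0 <= edge_diff e f x y. Proof. exact: ler0n. Qed.
Hint Resolve diff_ge0 : core.

Lemma norm_ind_diff e f x y : `|ind e x y - ind f x y| = edge_diff e f x y.
Proof.
by rewrite /edge_diff /edge_ind; case: (e x y); case: (f x y);
  rewrite /= ?subrr ?normr0 // ?subr0 ?sub0r ?normrN normr1.
Qed.

Lemma ind_bounds e x y : 0 <= ind e x y <= 1.
Proof. by rewrite ind_ge0 ind_le1. Qed.

Lemma coind_bounds e x y : 0 <= 1 - ind e x y <= 1.
Proof. by rewrite subr_ge0 ind_le1 gerBl ind_ge0. Qed.
Hint Resolve ind_bounds coind_bounds : core.

Lemma norm_coind_diff e f x y : `|(1 - ind e x y) - (1 - ind f x y)| = edge_diff e f x y.
Proof.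
rewrite -norm_ind_diff -normrN; congr (`|_|); ring.
Qed.

Lemma sum_const (k : R) : \sum_(x : T) k = n * k.
Proof. by rewrite sumr_const mulr_natl. Qed.

Definition star_weight e c x y z : R := ind e c x * ind e c y * ind e c z * (1 - ind e x y).
(* star_count is hom_count, where leaves may coincide, up to terms of order n^3. *)
Definition hom_count e : R := \sum_c \sum_x \sum_y \sum_z star_weight e c x y z.
Definition lower_count e : R :=
  2 * (\sum_c deg R e c) - 2 * (\sum_c nonadj_pairs R e c) - deg_sq R e.

Lemma star_countE e : star_count R e = hom_count e + lower_count e.
Proof.
rewrite /lower_count /deg_sq !mulr_sumr -!sumrB -big_split /=.
apply: eq_bigr => c _.
have -> : \sum_x \sum_y \sum_z star_weight e c x y z = deg R e c * nonadj_pairs R e c.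
  rewrite /nonadj_pairs mulr_sumr; apply: eq_bigr => x _.
  rewrite mulr_sumr; apply: eq_bigr => y _.
  rewrite /deg mulr_suml; apply: eq_bigr => z _; rewrite /star_weight; ring.
ring.
Qed.

(** Each of the two free variables contributes a factor n. The four versions correspond to the four
    pairs on which [star_weight] depends. *)
Lemma sum4_cx (g : T -> T -> R) :
  \sum_(c : T) \sum_(x : T) \sum_(y : T) \sum_(z : T) g c x = n ^+ 2 * \sum_c \sum_x g c x.
Proof.
rewrite mulr_sumr; apply: eq_bigr => c _; rewrite mulr_sumr; apply: eq_bigr => x _.
by rewrite (eq_bigr (fun _ : T => n * g c x)) => [|y _]; rewrite !sum_const // mulrA.
Qed.

Lemma sum4_cy (g : T -> T -> R) :
  \sum_(c : T) \sum_(x : T) \sum_(y : T) \sum_(z : T) g c y = n ^+ 2 * \sum_c \sum_x g c x.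
Proof.
rewrite -sum4_cx; apply: eq_bigr => c _; exact: exchange_big.
Qed.

Lemma sum4_cz (g : T -> T -> R) :
  \sum_(c : T) \sum_(x : T) \sum_(y : T) \sum_(z : T) g c z = n ^+ 2 * \sum_c \sum_x g c x.
Proof.
rewrite mulr_sumr; apply: eq_bigr => c _.
by rewrite (eq_bigr (fun _ : T => n * \sum_z g c z)) => [|x _]; rewrite !sum_const // mulrA.
Qed.

Lemma sum4_xy (g : T -> T -> R) :
  \sum_(c : T) \sum_(x : T) \sum_(y : T) \sum_(z : T) g x y = n ^+ 2 * \sum_c \sum_x g c x.
Proof.
rewrite sum_const expr2 -mulrA; congr (_ * _); rewrite mulr_sumr; apply: eq_bigr => x _.
by rewrite mulr_sumr; apply: eq_bigr => y _; rewrite sum_const.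
Qed.

Lemma ler_sum4 (F G : T -> T -> T -> T -> R) : (forall c x y z, F c x y z <= G c x y z) ->
  \sum_c \sum_x \sum_y \sum_z F c x y z <= \sum_c \sum_x \sum_y \sum_z G c x y z.
Proof. by move=> h; do 4![apply: ler_sum => ? _]. Qed.

Lemma ler_norm_sum4 (F : T -> T -> T -> T -> R) :
  `|\sum_c \sum_x \sum_y \sum_z F c x y z| <= \sum_c \sum_x \sum_y \sum_z `|F c x y z|.
Proof.
do 4![apply: le_trans (ler_norm_sum _ _ _) _; apply: ler_sum => ? _] => //.
Qed.

Lemma sum4D (F G : T -> T -> T -> T -> R) :
  \sum_c \sum_x \sum_y \sum_z (F c x y z + G c x y z) =
  \sum_c \sum_x \sum_y \sum_z F c x y z + \sum_c \sum_x \sum_y \sum_z G c x y z.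
Proof.
rewrite -big_split; apply: eq_bigr => c _; rewrite -big_split; apply: eq_bigr => x _.
by rewrite -big_split; apply: eq_bigr => y _; rewrite -big_split.
Qed.

Lemma sum4B (F G : T -> T -> T -> T -> R) :
  \sum_c \sum_x \sum_y \sum_z (F c x y z - G c x y z) =
  \sum_c \sum_x \sum_y \sum_z F c x y z - \sum_c \sum_x \sum_y \sum_z G c x y z.
Proof.
rewrite -sumrB; apply: eq_bigr => c _; rewrite -sumrB; apply: eq_bigr => x _.
by rewrite -sumrB; apply: eq_bigr => y _; rewrite -sumrB.
Qed.

Lemma weight_lipschitz e f c x y z :
  `|star_weight e c x y z - star_weight f c x y z| <=
  edge_diff e f c x + edge_diff e f c y + edge_diff e f c z + edge_diff e f x y.
Proof.
rewrite -!norm_ind_diff -[`|ind e x y - _|]normrN.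
have -> : - (ind e x y - ind f x y) = (1 - ind e x y) - (1 - ind f x y) by ring.
exact: mul4_lipschitz.
Qed.

Lemma hom_count_lipschitz e f :
  `|hom_count e - hom_count f| <= 4 * n ^+ 2 * (dist e f)%:R.
Proof.
rewrite /hom_count -sum4B; apply: le_trans (ler_norm_sum4 _) _.
apply: le_trans (ler_sum4 (weight_lipschitz e f)) _.
rewrite !sum4D sum4_cx sum4_cy sum4_cz sum4_xy -distE.
lra.
Qed.

Lemma norm_deg_diff e f c : `|deg R e c - deg R f c| <= \sum_x edge_diff e f c x.
Proof.
rewrite /deg -sumrB; apply: le_trans (ler_norm_sum _ _ _) _.
by apply: ler_sum => x _; rewrite norm_ind_diff.
Qed.

(** One order of n better than for [hom_count]. The constant is 2 + 2 * 3 + 2, from the degrees, the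
    non-adjacent pairs and the squared degrees. *)
Lemma lower_count_lipschitz e f : 1 <= n ->
  `|lower_count e - lower_count f| <= 10 * n * (dist e f)%:R.
Proof.
move=> n1.
have h1 : `|\sum_c deg R e c - \sum_c deg R f c| <= (dist e f)%:R.
  rewrite -sumrB distE; apply: le_trans (ler_norm_sum _ _ _) _.
  by apply: ler_sum => c _; exact: norm_deg_diff.
have h2 : `|\sum_c nonadj_pairs R e c - \sum_c nonadj_pairs R f c| <= 3 * n * (dist e f)%:R.
  rewrite -sumrB; apply: le_trans (ler_norm_sum _ _ _) _.
  have h : \sum_c `|nonadj_pairs R e c - nonadj_pairs R f c| <=
    \sum_c \sum_x \sum_y (edge_diff e f c x + edge_diff e f c y + edge_diff e f x y).
    apply: ler_sum => c _; rewrite -sumrB; apply: le_trans (ler_norm_sum _ _ _) _.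
    apply: ler_sum => x _; rewrite -sumrB; apply: le_trans (ler_norm_sum _ _ _) _.
    apply: ler_sum => y _; rewrite -[edge_diff e f x y]norm_coind_diff -!norm_ind_diff.
    apply: le_trans (mul_lipschitz _ _ (mul01 _ _) _) _ => //.
    by rewrite lerD2r; exact: mul_lipschitz.
  apply: le_trans h _; rewrite distE.
  have -> : \sum_c \sum_x \sum_y (edge_diff e f c x + edge_diff e f c y + edge_diff e f x y) =
    \sum_c \sum_x \sum_(y : T) edge_diff e f c x + \sum_c \sum_(x : T) \sum_y edge_diff e f c y +
    \sum_(c : T) \sum_x \sum_y edge_diff e f x y.
    rewrite -!big_split; apply: eq_bigr => c _; rewrite -!big_split; apply: eq_bigr => x _.
    by rewrite -!big_split.
  rewrite sum_const.
  have -> : \sum_c \sum_x \sum_(y : T) edge_diff e f c x = n * \sum_c \sum_x edge_diff e f c x.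
    rewrite mulr_sumr; apply: eq_bigr => c _; rewrite mulr_sumr; apply: eq_bigr => x _.
    exact: sum_const.
  have -> : \sum_c \sum_(x : T) \sum_y edge_diff e f c y = n * \sum_c \sum_x edge_diff e f c x.
    by rewrite mulr_sumr; apply: eq_bigr => c _; rewrite sum_const.
  lra.
have h3 : `|deg_sq R e - deg_sq R f| <= 2 * n * (dist e f)%:R.
  rewrite /deg_sq -sumrB; apply: le_trans (ler_norm_sum _ _ _) _.
  rewrite distE mulr_sumr; apply: ler_sum => c _.
  rewrite subr_sqr normrM mulrC; apply: ler_pM => //; last exact: norm_deg_diff.
  rewrite ger0_norm; last by rewrite addr_ge0 ?deg_ge0.
  by rewrite mulrDl mul1r lerD ?deg_le.
have D0 : 0 <= (dist e f)%:R :> R by [].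
rewrite /lower_count.
have -> : forall a b c a' b' c' : R, 2 * a - 2 * b - c - (2 * a' - 2 * b' - c')
  = 2 * (a - a') - 2 * (b - b') - (c - c') by move=> *; ring.
have := ler_wpM2r D0 n1; rewrite mul1r.
move: h1 h2 h3; rewrite !ler_norml => /andP[? ?] /andP[? ?] /andP[? ?] ?.
by apply/andP; split; lra.
Qed.

Lemma star_count_lipschitz e f : 1 <= n ->
  `|star_count R e - star_count R f| <= 14 * n ^+ 2 * (dist e f)%:R.
Proof.
move=> n1; rewrite !star_countE.
have -> : forall a b c d : R, a + b - (c + d) = (a - c) + (b - d) by move=> *; ring.
apply: le_trans (ler_normD _ _) _.
apply: le_trans (lerD (hom_count_lipschitz e f) (lower_count_lipschitz e f n1)) _.
have : n * (dist e f)%:R <= n ^+ 2 * (dist e f)%:R.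
  by rewrite ler_wpM2r // expr2 ler_peMl.
lra.
Qed.

End Perturbation.

(** * Second differences and first-order expansion of the homomorphism count *)

Section Expansion.
Variables (R : rcfType) (T : finType).
Implicit Types (e f : rel T) (c u v x y z : T).
Local Notation n := (#|T|%:R : R).
Local Notation ind := (@edge_ind R T).
Local Notation diff := (@edge_diff R T).
Local Notation weight := (@star_weight R T).
Local Notation hom_count := (@hom_count R T).

(** The eight ways to combine one of the pairs cx, cy, cz, xy with one of the other two variables; a
    single variable stays free, hence a single factor n. *)
Lemma sum4_mul (g : T -> T -> R) (h : T -> R) :
  [/\ \sum_(c : T) \sum_(x : T) \sum_(y : T) \sum_(z : T) g c x * h y = n * (\sum_c \sum_x g c x) * \sum_x h x,
   \sum_(c : T) \sum_(x : T) \sum_(y : T) \sum_(z : T) g c x * h z = n * (\sum_c \sum_x g c x) * \sum_x h x,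
   \sum_(c : T) \sum_(x : T) \sum_(y : T) \sum_(z : T) g c y * h x = n * (\sum_c \sum_x g c x) * \sum_x h x,
   \sum_(c : T) \sum_(x : T) \sum_(y : T) \sum_(z : T) g c y * h z = n * (\sum_c \sum_x g c x) * \sum_x h x &
   [/\ \sum_(c : T) \sum_(x : T) \sum_(y : T) \sum_(z : T) g c z * h x = n * (\sum_c \sum_x g c x) * \sum_x h x,
   \sum_(c : T) \sum_(x : T) \sum_(y : T) \sum_(z : T) g c z * h y = n * (\sum_c \sum_x g c x) * \sum_x h x,
   \sum_(c : T) \sum_(x : T) \sum_(y : T) \sum_(z : T) g x y * h c = n * (\sum_c \sum_x g c x) * \sum_x h x &
   \sum_(c : T) \sum_(x : T) \sum_(y : T) \sum_(z : T) g x y * h z = n * (\sum_c \sum_x g c x) * \sum_x h x]].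
Proof.
set H := \sum_x h x.
have E1 : \sum_(c : T) \sum_(x : T) \sum_(y : T) \sum_(z : T) g c x * h y = n * (\sum_c \sum_x g c x) * H.
  rewrite mulrAC mulr_sumr; apply: eq_bigr => c _; rewrite mulr_sumr; apply: eq_bigr => x _.
  rewrite (eq_bigr (fun y => n * g c x * h y)) => [|y _]; last by rewrite sum_const mulrA.
  by rewrite -mulr_sumr -/H; ring.
have E2 : \sum_(c : T) \sum_(x : T) \sum_(y : T) \sum_(z : T) g c x * h z = n * (\sum_c \sum_x g c x) * H.
  by rewrite -E1; apply: eq_bigr => c _; apply: eq_bigr => x _; exact: exchange_big.
have E3 : \sum_(c : T) \sum_(x : T) \sum_(y : T) \sum_(z : T) g c y * h x = n * (\sum_c \sum_x g c x) * H.
  by rewrite -E1; apply: eq_bigr => c _; exact: exchange_big.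
have E4 : \sum_(c : T) \sum_(x : T) \sum_(y : T) \sum_(z : T) g c y * h z = n * (\sum_c \sum_x g c x) * H.
  by rewrite -E2; apply: eq_bigr => c _; exact: exchange_big.
have E5 : \sum_(c : T) \sum_(x : T) \sum_(y : T) \sum_(z : T) g c z * h x = n * (\sum_c \sum_x g c x) * H.
  by rewrite -E3; apply: eq_bigr => c _; apply: eq_bigr => x _; exact: exchange_big.
have E6 : \sum_(c : T) \sum_(x : T) \sum_(y : T) \sum_(z : T) g c z * h y = n * (\sum_c \sum_x g c x) * H.
  by rewrite -E5; apply: eq_bigr => c _; exact: exchange_big.
have E8 : \sum_(c : T) \sum_(x : T) \sum_(y : T) \sum_(z : T) g x y * h z = n * (\sum_c \sum_x g c x) * H.
  rewrite sum_const -mulrA; congr (_ * _); rewrite mulr_suml; apply: eq_bigr => x _.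
  by rewrite mulr_suml; apply: eq_bigr => y _; rewrite -mulr_sumr.
have E7 : \sum_(c : T) \sum_(x : T) \sum_(y : T) \sum_(z : T) g x y * h c = n * (\sum_c \sum_x g c x) * H.
  rewrite exchange_big /= -E1; apply: eq_bigr => x _; rewrite exchange_big.
  exact: eq_bigr.
by split => //.
Qed.

(** A quadruple contributes only if it contains v, where the change takes place, and a pair avoiding
    v on which e1 and f1 differ. This leaves one free vertex, so the error has order n times the
    distance instead of n^2 times. *)
Lemma hom_count_second_diff v e1 e2 f1 f2 :
  (forall x y, x != v -> y != v -> e1 x y = e2 x y) ->
  (forall x y, x != v -> y != v -> f1 x y = f2 x y) ->
  (forall x y, (x == v) || (y == v) -> e1 x y = f1 x y) ->
  (forall x y, (x == v) || (y == v) -> e2 x y = f2 x y) ->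
  `|(hom_count e2 - hom_count e1) - (hom_count f2 - hom_count f1)|
    <= 16 * n * (dist e1 f1)%:R.
Proof.
move=> he hf h1 h2.
have d12 x y : diff e2 f2 x y = diff e1 f1 x y.
  rewrite /edge_diff; have [xv|xv] := boolP (x == v); first by rewrite h1 ?h2 ?xv // !eqxx.
  have [yv|yv] := boolP (y == v); first by rewrite h1 ?h2 ?yv ?orbT // !eqxx.
  by rewrite he // hf.
have dv x y : (x == v) || (y == v) -> diff e1 f1 x y = 0.
  by move=> h; rewrite /edge_diff h1 // eqxx.
pose i x : R := (x == v)%:R.
rewrite /hom_count -!sum4B; apply: le_trans (ler_norm_sum4 _) _.
have H c x y z : `|weight e2 c x y z - weight e1 c x y z - (weight f2 c x y z - weight f1 c x y z)|
  <= 2 * (diff e1 f1 c x * i y + diff e1 f1 c x * i z + diff e1 f1 c y * i x + diff e1 f1 c y * i z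
     + diff e1 f1 c z * i x + diff e1 f1 c z * i y + diff e1 f1 x y * i c + diff e1 f1 x y * i z).
  have w1 := weight_lipschitz R e1 f1 c x y z.
  have w2 := weight_lipschitz R e2 f2 c x y z; rewrite !d12 in w2.
  have w3 : [&& c != v, x != v, y != v & z != v] -> weight e2 c x y z - weight e1 c x y z - (weight f2 c x y z - weight f1 c x y z) = 0.
    case/and4P => cv xv yv zv; rewrite /star_weight /edge_ind !he // !hf //; ring.
  have w4 : `|weight e2 c x y z - weight e1 c x y z - (weight f2 c x y z - weight f1 c x y z)|
     <= 2 * (diff e1 f1 c x + diff e1 f1 c y + diff e1 f1 c z + diff e1 f1 x y).
    have -> : weight e2 c x y z - weight e1 c x y z - (weight f2 c x y z - weight f1 c x y z)
      = (weight e2 c x y z - weight f2 c x y z) - (weight e1 c x y z - weight f1 c x y z) by ring.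
    apply: le_trans (ler_normB _ _) _; lra.
  have g0 a b : 0 <= diff e1 f1 a b := diff_ge0 R e1 f1 a b.
  have z1 := g0 c x; have z2 := g0 c y; have z3 := g0 c z; have z4 := g0 x y.
  have v1 := dv c x; have v2 := dv c y; have v3 := dv c z; have v4 := dv x y.
  rewrite /i; move: w3 w4 v1 v2 v3 v4 z1 z2 z3 z4 {w1 w2}.
  move: (weight _ _ _ _ _ - weight _ _ _ _ _ - _) => W.
  move: (diff e1 f1 c x) (diff e1 f1 c y) (diff e1 f1 c z) (diff e1 f1 x y) => d1 d2 d3 d4.
  case: (c == v); case: (x == v); case: (y == v); case: (z == v); rewrite /= => w3 w4 v1 v2 v3 v4 z1 z2 z3 z4;
   try (rewrite w3 // normr0; lra);
   try have {}v1 := v1 erefl; try have {}v2 := v2 erefl; try have {}v3 := v3 erefl;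
   try have {}v4 := v4 erefl; clear w3; lra.
apply: le_trans (ler_sum4 H) _.
under eq_bigr => c _ do under eq_bigr => x _ do under eq_bigr => y _ do rewrite -mulr_sumr.
under eq_bigr => c _ do under eq_bigr => x _ do rewrite -mulr_sumr.
under eq_bigr => c _ do rewrite -mulr_sumr.
rewrite -mulr_sumr !sum4D.
have [-> -> -> -> [-> -> -> ->]] := sum4_mul (diff e1 f1) i.
have -> : \sum_x i x = 1.
  by rewrite /i (bigD1 v) //= eqxx big1 ?addr0 // => x /negPf ->.
rewrite -distE; lra.
Qed.

Section FirstOrder.
Variables (e f : rel T).
Hypotheses (e_sym : symmetric e) (f_sym : symmetric f).

Let E x y := ind e x y - ind f x y.
Let EC x y : E x y = E y x. Proof. by rewrite /E /edge_ind e_sym f_sym. Qed.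
Let fC x y : ind f x y = ind f y x. Proof. by rewrite /edge_ind f_sym. Qed.
Let d x y := diff e f x y.
Let dC x y : d x y = d y x. Proof. by rewrite /d /edge_diff e_sym f_sym. Qed.
Let d0 x y : 0 <= d x y := diff_ge0 R e f x y.

(* The coefficient of E x y in the first-order expansion of hom_count at f. *)
Definition flip_gain x y : R :=
  2 * deg R f x * (\sum_z ind f x z * (1 - ind f y z)) + nonadj_pairs R f x
  - \sum_c ind f c x * ind f c y * deg R f c.

Let first_order :
  \sum_c \sum_x \sum_y \sum_z
    (E c x * ind f c y * ind f c z * (1 - ind f x y)
     + ind f c x * E c y * ind f c z * (1 - ind f x y)
     + ind f c x * ind f c y * E c z * (1 - ind f x y)
     - ind f c x * ind f c y * ind f c z * E x y)
  = \sum_x \sum_y E x y * flip_gain x y.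
Proof.
rewrite sum4B !sum4D.
set T1 := \sum_c _; set T2 := \sum_c _; set T3 := \sum_c _; set T4 := \sum_c _.
have e2 : T2 = T1.
  rewrite /T2 /T1; apply: eq_bigr => c _; rewrite exchange_big; apply: eq_bigr => x _.
  by apply: eq_bigr => y _; apply: eq_bigr => z _ /=; rewrite [ind f y x]fC; ring.
have e1 : T1 = \sum_x \sum_y E x y * (deg R f x * (\sum_z ind f x z * (1 - ind f y z))).
  apply: eq_bigr => c _; apply: eq_bigr => x _.
  rewrite mulrA mulr_sumr; apply: eq_bigr => y _.
  by rewrite /deg mulr_sumr mulr_suml; apply: eq_bigr => z _; ring.
have e3 : T3 = \sum_x \sum_y E x y * nonadj_pairs R f x.
  apply: eq_bigr => c _; rewrite -mulr_suml.
  rewrite /nonadj_pairs mulr_sumr; apply: eq_bigr => x _.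
  rewrite mulr_sumr; apply: eq_bigr => y _.
  by rewrite mulr_suml; apply: eq_bigr => z _; ring.
have e4 : T4 = \sum_x \sum_y E x y * (\sum_c ind f c x * ind f c y * deg R f c).
  rewrite /T4 exchange_big; apply: eq_bigr => x _; rewrite exchange_big; apply: eq_bigr => y _.
  rewrite mulr_sumr; apply: eq_bigr => c _.
  by rewrite /deg !mulr_sumr; apply: eq_bigr => z _; ring.
rewrite e2 e1 e3 e4 -!big_split -sumrB; apply: eq_bigr => x _.
rewrite -!big_split -sumrB; apply: eq_bigr => y _ /=; rewrite /flip_gain; ring.
Qed.

Variables (gam eta kap : R).
Hypothesis row_small : forall x, \sum_y d x y <= gam * n.
Hypothesis dist_small : (dist e f)%:R <= eta * n ^+ 2.
Hypothesis flips_lose : forall x y,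
  E x y * (flip_gain x y + flip_gain y x) <= - (kap * n ^+ 2) * d x y.

Let row x := \sum_y d x y.
Let sum_row : \sum_x row x = (dist e f)%:R. Proof. by rewrite distE. Qed.
Let row_sq : \sum_x row x ^+ 2 <= gam * n * (dist e f)%:R.
Proof.
rewrite -sum_row mulr_sumr; apply: ler_sum => x _; rewrite expr2.
by apply: ler_wpM2r; [apply: sumr_ge0 | exact: row_small].
Qed.

(** Among the six products of two errors, five belong to pairs sharing a vertex and give n times the
    sum of squared rows; the disjoint pairs cz and xy give the squared distance. *)
Let pair_sums :
  \sum_c \sum_x \sum_y \sum_(z : T)
    (d c x * d c y + d c x * d c z + d c x * d x y + d c y * d c z + d c y * d x y + d c z * d x y)
  = 5 * n * \sum_x row x ^+ 2 + (dist e f)%:R ^+ 2.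
Proof.
rewrite !sum4D.
have A : \sum_(c : T) \sum_x \sum_y \sum_(z : T) d c x * d c y = n * \sum_x row x ^+ 2.
  rewrite mulr_sumr; apply: eq_bigr => c _; rewrite expr2 {1}/row mulr_suml mulr_sumr.
  apply: eq_bigr => x _; rewrite /row !mulr_sumr; apply: eq_bigr => y _.
  by rewrite sum_const.
have B : \sum_(c : T) \sum_x \sum_(y : T) \sum_z d c x * d c z = n * \sum_x row x ^+ 2.
  by rewrite -A; apply: eq_bigr => c _; apply: eq_bigr => x _; exact: exchange_big.
have C : \sum_(c : T) \sum_x \sum_y \sum_(z : T) d c x * d x y = n * \sum_x row x ^+ 2.
  rewrite -A exchange_big; apply: eq_bigr => c _; apply: eq_bigr => x _.
  by apply: eq_bigr => y _; apply: eq_bigr => z _; rewrite dC.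
have D : \sum_(c : T) \sum_(x : T) \sum_y \sum_z d c y * d c z = n * \sum_x row x ^+ 2.
  by rewrite -B; apply: eq_bigr => c _; exact: exchange_big.
have F : \sum_(c : T) \sum_x \sum_y \sum_(z : T) d c y * d x y = n * \sum_x row x ^+ 2.
  rewrite -C; apply: eq_bigr => c _; rewrite exchange_big; apply: eq_bigr => x _.
  by apply: eq_bigr => y _; apply: eq_bigr => z _; rewrite [d y x]dC.
have G : \sum_(c : T) \sum_(x : T) \sum_(y : T) \sum_z d c z * d x y = (dist e f)%:R ^+ 2.
  rewrite -sum_row expr2 mulr_suml; apply: eq_bigr => c _.
  rewrite mulr_sumr; apply: eq_bigr => x _; rewrite {2}/row mulr_sumr; apply: eq_bigr => y _.
  by rewrite -mulr_suml.
rewrite A B C D F G; ring.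
Qed.

(** The linear term loses kap/2 per ordered wrong pair, in units of n^2. In the second-order
    remainder, small rows bound the five products sharing a vertex by 5 gam and the small distance
    bounds the last one by eta. *)
Lemma hom_count_first_order :
  hom_count e - hom_count f
  <= - (kap / 2 - 5 * gam - eta) * n ^+ 2 * (dist e f)%:R.
Proof.
have D0 : 0 <= (dist e f)%:R :> R by [].
set F := \sum_x \sum_y E x y * flip_gain x y.
have hF : 2 * F <= - (kap * n ^+ 2) * (dist e f)%:R.
  have -> : 2 * F = \sum_x \sum_y E x y * (flip_gain x y + flip_gain y x).
    have -> : 2 * F = F + F by ring.
    rewrite {2}/F exchange_big -big_split; apply: eq_bigr => x _.
    rewrite -big_split; apply: eq_bigr => y _ /=; rewrite (EC y x); ring.
  rewrite distE mulr_sumr; apply: ler_sum => x _; rewrite mulr_sumr.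
  by apply: ler_sum => y _; exact: flips_lose.
have hrem : `|hom_count e - hom_count f - F| <= 5 * n * \sum_x row x ^+ 2 + (dist e f)%:R ^+ 2.
  rewrite /F -first_order /hom_count -!sum4B -pair_sums.
  apply: le_trans (ler_norm_sum4 _) _; apply: ler_sum4 => c x y z.
  have /= := @mul4_taylor R (ind f c x) (ind f c y) (ind f c z) (1 - ind f x y)
    (ind e c x) (ind e c y) (ind e c z) (1 - ind e x y).
  have nE a b : `|ind e a b - ind f a b| = d a b by exact: norm_ind_diff.
  have nE' a b : `|(1 - ind e a b) - (1 - ind f a b)| = d a b by exact: norm_coind_diff.
  rewrite !nE nE' !ind_bounds !coind_bounds => /(_ isT isT isT isT isT isT isT isT).
  apply: le_trans; rewrite le_eqVlt; apply/orP; left; apply/eqP; congr (`|_|).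
  rewrite /star_weight /E; ring.
have hD : (dist e f)%:R ^+ 2 <= eta * n^+2 * (dist e f)%:R :> R.
  by rewrite expr2; apply: ler_wpM2r.
have hn : 0 <= 5 * n by rewrite mulr_ge0.
have := ler_wpM2l hn row_sq.
move: hrem; rewrite ler_norml => /andP[_ hrem] hr.
lra.
Qed.
End FirstOrder.
End Expansion.

(** * Complete multipartite graphs *)

Section Multipartite.
Variables (R : rcfType) (T I : finType) (phi : T -> I).
Implicit Types (c u v x y z : T) (i j : I).
Local Notation n := (#|T|%:R : R).

Definition multipartite : rel T := fun x y => phi x != phi y.
Definition part_size j : R := \sum_x (phi x == j)%:R.
Definition part_sq : R := \sum_x part_size (phi x).

Lemma multipartite_sym : symmetric multipartite.
Proof. by move=> x y; rewrite /multipartite eq_sym. Qed.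
Lemma multipartite_irr : irreflexive multipartite.
Proof. by move=> x; rewrite /multipartite eqxx. Qed.

Lemma part_size_ge0 j : 0 <= part_size j.
Proof. by apply: sumr_ge0 => x _; exact: ler0n. Qed.

Lemma part_size_le j : part_size j <= n.
Proof.
rewrite -[n]mulr1 -sum_const; apply: ler_sum => x _; by case: (_ == _).
Qed.

Lemma sum_by_part (F : I -> R) : \sum_x F (phi x) = \sum_j part_size j * F j.
Proof.
rewrite (partition_big phi predT) //=; apply: eq_bigr => j _.
rewrite /part_size mulr_suml [RHS]big_mkcond /= [LHS]big_mkcond /=; apply: eq_bigr => x _.
by case: eqP => [->|_]; rewrite ?mul1r ?mul0r.
Qed.

Lemma sum_part_size : \sum_j part_size j = n.
Proof.
rewrite -[n]mulr1 -sum_const (sum_by_part (fun=> 1)).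
by apply: eq_bigr => j _; rewrite mulr1.
Qed.

Lemma part_sqE : part_sq = \sum_j part_size j ^+ 2.
Proof. by rewrite /part_sq sum_by_part. Qed.

Lemma ind_multipartite x y : edge_ind R multipartite x y = 1 - (phi y == phi x)%:R.
Proof.
by rewrite /edge_ind /multipartite eq_sym; case: (_ == _); rewrite /= ?subrr ?subr0.
Qed.

Lemma deg_multipartite x : deg R multipartite x = n - part_size (phi x).
Proof.
rewrite /deg -[n]mulr1 -sum_const -sumrB; apply: eq_bigr => y _.
exact: ind_multipartite.
Qed.

Lemma common_multipartite x y :
  \sum_z edge_ind R multipartite x z * (1 - edge_ind R multipartite y z) =
  (phi x != phi y)%:R * part_size (phi y).
Proof.
rewrite mulr_sumr; apply: eq_bigr => z _.
rewrite !ind_multipartite subKr.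
have [->|h] := eqVneq (phi z) (phi y); last by rewrite !mulr0.
by rewrite eq_sym; case: eqP; rewrite /= ?subrr ?subr0.
Qed.

Lemma nonadj_multipartite x :
  nonadj_pairs R multipartite x = part_sq - part_size (phi x) ^+ 2.
Proof.
have -> : part_size (phi x) ^+ 2 = \sum_y (phi y == phi x)%:R * part_size (phi y).
  rewrite expr2 {1}/part_size mulr_suml; apply: eq_bigr => y _.
  by case: eqP => [->|]; rewrite ?mul0r.
rewrite /part_sq -sumrB; apply: eq_bigr => y _.
rewrite (eq_bigr (fun z => edge_ind R multipartite x z * (1 - edge_ind R multipartite y z) * edge_ind R multipartite x y)).
  rewrite -mulr_suml common_multipartite eq_sym ind_multipartite.
  by case: eqP => _; rewrite /=; ring.
by move=> z _; rewrite -!mulrA mulrC -mulrA; congr (_ * _).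
Qed.

Lemma star_count_multipartite :
  star_count R multipartite =
  \sum_x (n - part_size (phi x) - 2)
    * (part_sq - part_size (phi x) ^+ 2 - (n - part_size (phi x))).
Proof.
by apply: eq_bigr => x _; rewrite deg_multipartite nonadj_multipartite.
Qed.

Lemma cherry_multipartite x y :
  \sum_c edge_ind R multipartite c x * edge_ind R multipartite c y * deg R multipartite c =
  n ^+ 2 - part_sq - part_size (phi x) * (n - part_size (phi x))
   - (phi x != phi y)%:R * (part_size (phi y) * (n - part_size (phi y))).
Proof.
have h z : part_size (phi z) * (n - part_size (phi z)) =
   \sum_c (phi c == phi z)%:R * (n - part_size (phi c)).
  rewrite {1}/part_size mulr_suml; apply: eq_bigr => c _.
  by case: eqP => [->|]; rewrite ?mul0r.
rewrite (h x) (h y) mulr_sumr expr2 -sum_const /part_sq -!sumrB; apply: eq_bigr => c _.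
rewrite deg_multipartite !ind_multipartite.
rewrite [phi x == phi c]eq_sym [phi y == phi c]eq_sym.
have [->|cx] := eqVneq (phi c) (phi x).
  by case: (phi x == phi y); rewrite /=; ring.
have [cy|cy] := eqVneq (phi c) (phi y); last by rewrite /=; ring.
by have [xy|xy] := eqVneq (phi x) (phi y); [rewrite cy xy eqxx in cx | rewrite /=; ring].
Qed.

Lemma flip_gain_same x y : phi x = phi y ->
  flip_gain R multipartite x y + flip_gain R multipartite y x =
  4 * (part_sq - part_size (phi x) ^+ 2) - 2 * n * (n - part_size (phi x)).
Proof.
move=> xy; rewrite /flip_gain !common_multipartite !cherry_multipartite !nonadj_multipartite.
by rewrite xy eqxx /=; ring.
Qed.

Lemma flip_gain_cross x y (a := part_size (phi x)) (b := part_size (phi y)) : phi x != phi y ->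
  flip_gain R multipartite x y + flip_gain R multipartite y x =
  2 * (n - a) * b + 2 * (n - b) * a + 2 * part_sq - a ^+ 2 - b ^+ 2
  - 2 * (n * (n - a - b) - (part_sq - a ^+ 2 - b ^+ 2)).
Proof.
move=> xy; rewrite /flip_gain !common_multipartite !cherry_multipartite !nonadj_multipartite.
rewrite !deg_multipartite [phi y == _]eq_sym xy /= -/a -/b; ring.
Qed.

Definition part_ratio j := part_size j / n.

Lemma part_ratio_ge0 j : 0 <= part_ratio j.
Proof. by rewrite divr_ge0 ?part_size_ge0. Qed.

Hypothesis n_gt0 : 0 < n.

Lemma part_sizeE j : part_size j = n * part_ratio j.
Proof. by rewrite /part_ratio mulrCA divff ?mulr1 ?gt_eqF. Qed.

Lemma sum_part_ratio : \sum_j part_ratio j = 1.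
Proof. by rewrite -mulr_suml sum_part_size divff // gt_eqF. Qed.

Lemma partite_densityE :
  \sum_x (n - part_size (phi x)) * (part_sq - part_size (phi x) ^+ 2) =
  n ^+ 4 * partite_density part_ratio.
Proof.
rewrite (sum_by_part (fun j => (n - part_size j) * (part_sq - part_size j ^+ 2))) part_sqE.
set r := part_ratio; set S := \sum_j r j ^+ 2.
have -> : \sum_j part_size j ^+ 2 = n ^+ 2 * S.
  by rewrite /S mulr_sumr; apply: eq_bigr => j _; rewrite part_sizeE exprMn.
rewrite /partite_density -/S.
have -> : n ^+ 4 * (S * (1 - S) - \sum_j r j ^+ 3 + \sum_j r j ^+ 4)
  = n ^+ 4 * (S * \sum_j r j - S * S - \sum_j r j ^+ 3 + \sum_j r j ^+ 4).
  by rewrite sum_part_ratio; ring.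
have SE : S = \sum_j r j ^+ 2 by [].
clearbody S; have -> : S * S = \sum_j S * r j ^+ 2 by rewrite {2}SE mulr_sumr.
rewrite [S * \sum_j _]mulr_sumr -sumrB -sumrB -big_split [RHS]mulr_sumr /=.
by apply: eq_bigr => j _; rewrite !part_sizeE /r; ring.
Qed.

(** Every neighbour y of x contributes the pair (y, y) to [nonadj_pairs], so these pairs alone make
    up the degree. *)
Let excess_ge0 x : 0 <= part_sq - part_size (phi x) ^+ 2 - (n - part_size (phi x)).
Proof.
rewrite -nonadj_multipartite -deg_multipartite /deg /nonadj_pairs -sumrB.
apply: sumr_ge0 => y _; rewrite (bigD1 y) //= /edge_ind /multipartite eqxx /= subr0 mulr1.
have : 0 <= \sum_(z | z != y) (phi x != phi y)%:R * (phi x != phi z)%:R * (1 - (phi y != phi z)%:R) :> R.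
  by apply: sumr_ge0 => z _; rewrite !mulr_ge0 // subr_ge0; case: (_ != _).
by move: (\sum_(z | _) _) => S; case: (_ != _); rewrite /=; lra.
Qed.

Lemma star_count_multipartite_le :
  star_count R multipartite <= n ^+ 4 * partite_density part_ratio.
Proof.
rewrite star_count_multipartite -partite_densityE; apply: ler_sum => x _.
have h0 := excess_ge0 x; have h1 := part_size_le (phi x).
apply: (@le_trans _ _ ((n - part_size (phi x)) * (part_sq - part_size (phi x) ^+ 2 - (n - part_size (phi x))))).
  by apply: ler_wpM2r => //; rewrite gerBl.
by apply: ler_wpM2l; rewrite ?subr_ge0 // gerBl subr_ge0.
Qed.

(** With D the degree of a vertex and N its number of non-adjacent pairs, (D - 2) (N - D) is below D
    N by at most D^2 + 2 N <= 3 n^2. *)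
Lemma star_count_multipartite_ge :
  n ^+ 4 * partite_density part_ratio - 3 * n ^+ 3 <= star_count R multipartite.
Proof.
rewrite star_count_multipartite -partite_densityE.
have -> : 3 * n ^+ 3 = \sum_(x : T) 3 * n ^+ 2 by rewrite sum_const; ring.
rewrite -sumrB; apply: ler_sum => x _.
have h0 := excess_ge0 x; have h1 := part_size_le (phi x); have h2 := part_size_ge0 (phi x).
have h3 : part_sq <= n ^+ 2.
  by rewrite /part_sq expr2 -sum_const; apply: ler_sum => y _; exact: part_size_le.
set a := part_size _ in h0 h1 h2 *; nra.
Qed.
End Multipartite.

(** If non-adjacent vertices are twins, non-adjacency is an equivalence; its classes, the sets of
    non-neighbours, serve as names of the parts. *)
Lemma multipartite_of_twins (T : finType) (e : rel T) : symmetric e -> irreflexive e ->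
  (forall u v, ~~ e u v -> e u =1 e v) ->
  e =2 multipartite (fun x => [set y | ~~ e x y]).
Proof.
move=> es ei tw x y; rewrite /multipartite.
have [exy|exy] := boolP (e x y).
  symmetry; apply/eqP => /setP/(_ y); by rewrite !inE exy ei.
by symmetry; apply/negbTE/negPn/eqP/setP => z; rewrite !inE (tw _ _ exy).
Qed.

Lemma eq_rel (T : Type) (e f : rel T) : e =2 f -> e = f.
Proof. by move=> h; apply: funext => x; apply: funext => y; exact: h. Qed.

(** Relations are encoded as finite functions on pairs, a finite type over which a maximum can be
    taken. *)
Lemma graph_argmax (R : realDomainType) (T : finType) (P : rel T -> Prop) (F : rel T -> R) e0 :
  symmetric e0 -> irreflexive e0 -> P e0 ->
  exists e, [/\ symmetric e, irreflexive e, P e &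
    forall f, symmetric f -> irreflexive f -> P f -> F f <= F e].
Proof.
move=> s0 i0 p0.
pose dec (g : {ffun T * T -> bool}) : rel T := fun x y => g (x, y).
pose enc (e : rel T) : {ffun T * T -> bool} := [ffun p => e p.1 p.2].
have decK e : dec (enc e) = e by apply: eq_rel => x y; rewrite /dec ffunE.
pose ok g := `[< [/\ symmetric (dec g), irreflexive (dec g) & P (dec g)] >].
have ok0 : ok (enc e0) by apply/asboolP; rewrite decK.
case: (@arg_maxP _ _ _ (enc e0) ok (F \o dec) ok0) => g /asboolP[gs gi gP] gmax.
exists (dec g); split => // f fs fi fP.
have := gmax (enc f); rewrite /= decK; apply.
by apply/asboolP; rewrite decK.
Qed.

(** * Complete multipartite maximizers and the upper bound *)

Section Symmetrization.
Variables (R : rcfType) (T : finType).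
Implicit Types (e f : rel T).
Local Notation n := (#|T|%:R : R).

(* The number of cherries strictly increases under cloning, and breaks ties. *)
Definition augmented_count e : R := star_count R e + deg_sq R e.

Lemma deg_sq_ge0 e : 0 <= deg_sq R e.
Proof. by apply: sumr_ge0 => c _; exact: sqr_ge0. Qed.

Lemma deg_sq_le e : deg_sq R e <= n ^+ 3.
Proof.
have -> : n ^+ 3 = n * n ^+ 2 by ring.
rewrite -sum_const; apply: ler_sum => c _.
by rewrite lerXn2r // ?nnegrE ?deg_ge0 ?deg_le.
Qed.

(** The two clonings together exceed twice the augmented count: a vertex adjacent to exactly one of
    u, v has degree at least 1, so the gain in stars is nonnegative, and it adds 2 to the squared
    degrees. *)
Lemma clone_increases e u v : symmetric e -> irreflexive e -> ~~ e u v -> ~ (e u =1 e v) ->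
  augmented_count e < augmented_count (clone e u v) \/
  augmented_count e < augmented_count (clone e v u).
Proof.
move=> es ei uv ntw.
have h1 := star_count_clone R es ei uv; have h2 := deg_sq_clone R es ei uv.
have [c hc] : exists c, e c u != e c v.
  apply: contrapT => h; apply: ntw => y; apply/eqP/negPn/negP => hy; apply: h.
  by exists y; rewrite [e y u]es [e y v]es.
have h3 : 1 <= \sum_c (e c u != e c v)%:R :> R.
  by rewrite (bigD1 c) //= hc lerDl; apply: sumr_ge0 => y _; exact: ler0n.
have h4 : 0 <= \sum_c (e c u != e c v)%:R * (2 * deg R e c - 2).
  apply: sumr_ge0 => y _; have [_|hy] := eqVneq; first by rewrite mul0r.
  rewrite mul1r subr_ge0 -[leLHS]mulr1 ler_pM2l // /deg.
  have [w ew] : exists w, e y w.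
    by move: hy; case yu : (e y u); [exists u | case yv : (e y v) => //; exists v].
  rewrite (bigD1 w) //= /edge_ind ew lerDl; apply: sumr_ge0 => z _; exact: ler0n.
rewrite /augmented_count.
case: (ltP (star_count R e + deg_sq R e) (star_count R (clone e u v) + deg_sq R (clone e u v))) => h5; first by left.
right; lra.
Qed.

(** A maximizer of the augmented count is complete multipartite, hence bounded by
    [partite_density_le]; the term n^3 pays for its squared degrees. *)
Lemma star_count_le_opt e : symmetric e -> irreflexive e -> 0 < n ->
  star_count R e <= opt_density R * n ^+ 4 + n ^+ 3.
Proof.
move=> es ei n0.
have [f [fs fi _ fmax]] := graph_argmax (P := fun=> True) augmented_count es ei I.
have tw u v : ~~ f u v -> f u =1 f v.
  move=> uv; apply: contrapT => ntw.
  have sc a b : augmented_count (clone f a b) <= augmented_count f.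
    by apply: fmax => //; [exact: clone_sym | exact: clone_irr].
  by have [] := clone_increases fs fi uv ntw; rewrite ltNge sc.
have fE := eq_rel (multipartite_of_twins fs fi tw).
have h1 := fmax e es ei I.
have h2 : star_count R f <= opt_density R * n ^+ 4.
  rewrite fE; apply: le_trans (star_count_multipartite_le _ n0) _.
  rewrite mulrC; apply: ler_wpM2r; first by rewrite exprn_ge0.
  by apply: partite_density_le; [exact: part_ratio_ge0 | exact: sum_part_ratio].
move: h1; rewrite /augmented_count; have := deg_sq_ge0 e; have := deg_sq_le f.
move: (opt_density R * _) h2 => L; lra.
Qed.
End Symmetrization.

(** * Near-optimal ratios of five parts *)

Section NearOptimal.
Variable R : rcfType.

(** A numerical window around the optimal ratios, about 0.6107 and 0.0973, that suffices for the
    later estimates. *)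
Definition near_optimal (x : 'I_5 -> R) :=
  exists2 j0, 609/1000 <= x j0 <= 612/1000 & forall j, j != j0 -> 96/1000 <= x j <= 985/1000/10.

Lemma near_optimal_of_density (x : 'I_5 -> R) :
  (forall j, 0 <= x j) -> \sum_j x j = 1 ->
  opt_density R - (1/1000)^+2/1000/1000/100 <= partite_density x -> near_optimal x.
Proof.
move=> x0 x1 h.
have e1 : 0 < 1/1000 :> R by lra.
have e2 : 1/1000 <= 1 :> R by lra.
have [j0 [P [hj0 P4 hb hs]]] := partite_density_stable x0 x1 e1 e2 h.
clear h x0 x1 e1 e2.
have [b1 b2] := big_part_bounds R.
exists j0.
  by move: hb; rewrite ler_norml => /andP[u1 u2]; apply/andP; split; lra.
move=> j hj.
have jP : j \in P.
  have sub : P \subset [set~ j0] by apply/fintype.subsetP => i iP; rewrite !inE; apply: contraNneq hj0 => <-.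
  have/eqP -> : P == [set~ j0] by rewrite eqEcard sub P4 cardsC1 card_ord.
  by rewrite !inE.
have := hs _ jP; rewrite /small_part ler_norml => /andP[u1 u2].
by apply/andP; split; lra.
Qed.

Lemma near_optimal_sq (x : 'I_5 -> R) : near_optimal x ->
  exists j0, [/\ 609/1000 <= x j0 <= 612/1000, forall j, j != j0 -> 96/1000 <= x j <= 985/1000/10 &
    368/100/100 <= \sum_j x j ^+ 2 - x j0 ^+ 2 <= 389/100/100].
Proof.
move=> [j0 h0 h1]; exists j0; split => //.
rewrite (bigD1 j0) //= [x j0 ^+ 2 + _]addrC addrK.
have h2 j : j != j0 -> 92/100/100 <= x j ^+ 2 <= 971/100/100/10.
  by move=> /h1 /andP[u1 u2]; apply/andP; split; nra.
have cst (k : R) : \sum_(j < 5 | j != j0) k = 4 * k.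
  by rewrite sumr_const (cardC1 j0) card_ord mulr_natl.
apply/andP; split.
  apply: (@le_trans _ _ (\sum_(j < 5 | j != j0) 92/100/100)); first by rewrite cst; lra.
  by apply: ler_sum => j /h2 /andP[].
apply: (@le_trans _ _ (\sum_(j < 5 | j != j0) 971/100/100/10)); last by rewrite cst; lra.
by apply: ler_sum => j /h2 /andP[].
Qed.
End NearOptimal.

(** * Graphs close to a near-optimal complete 5-partite graph *)

Section SmallDegreeErrors.
Variables (R : rcfType) (T : finType) (e : rel T) (phi : T -> 'I_5).
Local Notation n := (#|T|%:R : R).
Hypotheses (e_sym : symmetric e) (n_ge1 : 1 <= n).
Hypothesis phi_opt : near_optimal (part_ratio R phi).

Let n_gt0 : 0 < n. Proof. exact: lt_le_trans n_ge1. Qed.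

(** A correct pair contributes zero. By the explicit flip gains in the window, an edge inside a part
    and a non-edge between parts each lose n^2/10. *)
Let flips_lose x y :
  (edge_ind R e x y - edge_ind R (multipartite phi) x y)
    * (flip_gain R (multipartite phi) x y + flip_gain R (multipartite phi) y x)
  <= - (1/10 * n ^+ 2) * edge_diff R e (multipartite phi) x y.
Proof.
have [j0 [h0 h1 hS]] := near_optimal_sq phi_opt.
set S := \sum_j _ in hS.
have QE : part_sq R phi = n ^+ 2 * S.
  by rewrite part_sqE /S mulr_sumr; apply: eq_bigr => j _; rewrite part_sizeE // exprMn.
have n2 : 0 <= n ^+ 2 by rewrite exprn_ge0.
have bnd j : j = j0 \/ j != j0 by case: (eqVneq j j0); [left|right].
have [xy|xy] := eqVneq (phi x) (phi y).
  rewrite (flip_gain_same R xy) QE part_sizeE //.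
  set a := part_ratio R phi (phi x).
  have key : 4 * (S - a ^+ 2) - 2 * (1 - a) <= - (1/10).
    rewrite /a; move: h0 hS => /andP[u1 u2] /andP[u3 u4].
    have [->|/h1/andP[u5 u6]] := bnd (phi x); first lra.
    move: (part_ratio R phi (phi x)) (part_ratio R phi j0) u1 u2 u3 u4 u5 u6 => b c *; nra.
  rewrite /edge_diff /edge_ind /multipartite xy eqxx /=.
  case: (e x y); rewrite /= ?subr0 ?mul0r ?mulr0 // mul1r mulr1.
  by have := ler_wpM2l n2 key; move: n a S {n2 QE hS key} => m a S; lra.
rewrite flip_gain_cross // QE !part_sizeE //.
set a := part_ratio R phi (phi x); set b := part_ratio R phi (phi y).
have key : 1/10 <= 2 * (1 - a) * b + 2 * (1 - b) * a + 2 * S - a ^+ 2 - b ^+ 2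
   - 2 * ((1 - a - b) - (S - a ^+ 2 - b ^+ 2)).
  rewrite /a /b; move: h0 hS => /andP[u1 u2] /andP[u3 u4].
  have [ex|ex] := bnd (phi x); have [ey|ey] := bnd (phi y).
  - by rewrite ex ey eqxx in xy.
  - have /andP[u5 u6] := h1 _ ey; rewrite ex.
    move: (part_ratio R phi (phi y)) (part_ratio R phi j0) u1 u2 u3 u4 u5 u6 => c d *; nra.
  - have /andP[u5 u6] := h1 _ ex; rewrite ey.
    move: (part_ratio R phi (phi x)) (part_ratio R phi j0) u1 u2 u3 u4 u5 u6 => c d *; nra.
  - have /andP[u5 u6] := h1 _ ex; have /andP[u7 u8] := h1 _ ey.
    move: (part_ratio R phi (phi x)) (part_ratio R phi (phi y)) (part_ratio R phi j0) u1 u2 u3 u4 u5 u6 u7 u8 => c d g *; nra.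
rewrite /edge_diff /edge_ind /multipartite xy /=.
case: (e x y); rewrite /= ?subrr ?mul0r ?mulr0 // sub0r mulN1r mulr1 lerN2.
by have := ler_wpM2l n2 key; move: n a b S {n2 QE hS key} => m a b S; lra.
Qed.

(** In units of n^2 per wrong pair, the first-order loss is 1/20, the second-order terms return at
    most 6/1000, and the lower-order terms at most 1/100 because 1000 <= n. *)
Lemma small_degree_errors :
  (forall x, \sum_y edge_diff R e (multipartite phi) x y <= 1/1000 * n) ->
  (dist e (multipartite phi))%:R <= 1/1000 * n ^+ 2 ->
  1000 <= n ->
  star_count R e + 1/100 * n ^+ 2 * (dist e (multipartite phi))%:R
    <= star_count R (multipartite phi).
Proof.
move=> row D n1000.
have := hom_count_first_order e_sym (multipartite_sym phi) row D flips_lose.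
have := lower_count_lipschitz e (multipartite phi) n_ge1.
rewrite !star_countE ler_norml => /andP[_].
move: (hom_count _ _) (hom_count _ _) (lower_count _ _) (lower_count _ _) => h1 h2 l1 l2.
have : n * (dist e (multipartite phi))%:R * 1000 <= n ^+ 2 * (dist e (multipartite phi))%:R.
  have -> : n * (dist e (multipartite phi))%:R * 1000 = 1000 * (n * (dist e (multipartite phi))%:R) by ring.
  by rewrite expr2 -mulrA; apply: ler_wpM2r => //; rewrite mulr_ge0.
have : 0 <= n ^+ 2 * (dist e (multipartite phi))%:R by rewrite mulr_ge0 // exprn_ge0.
move: (dist _ _)%:R => d; move: n => m; lra.
Qed.
End SmallDegreeErrors.

(** * Replacing the neighbourhood of one vertex *)

Section SetNeighbours.
Variables (R : rcfType) (T : finType).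
Implicit Types (e f : rel T) (v x y : T) (g : pred T).
Local Notation n := (#|T|%:R : R).

Definition set_nbrs e v g : rel T := fun x y =>
  if x == v then (y != v) && g y else if y == v then g x else e x y.

Definition recolor (I : finType) (phi : T -> I) v j x := if x == v then j else phi x.

Lemma set_nbrs_sym e v g : symmetric e -> symmetric (set_nbrs e v g).
Proof.
move=> es x y; rewrite /set_nbrs.
by have [xv|xv] := eqVneq x v; have [yv|yv] := eqVneq y v; rewrite ?xv ?yv // es.
Qed.

Lemma set_nbrs_irr e v g : irreflexive e -> irreflexive (set_nbrs e v g).
Proof. by move=> ei x; rewrite /set_nbrs; case: eqP. Qed.

Lemma set_nbrs_id e v : symmetric e -> irreflexive e -> set_nbrs e v (e v) = e.
Proof.
move=> es ei; apply: eq_rel => x y; rewrite /set_nbrs.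
by have [xv|xv] := eqVneq x v; have [yv|yv] := eqVneq y v; rewrite ?xv ?yv ?ei // es.
Qed.

Lemma set_nbrs_multipartite (I : finType) (phi : T -> I) v j :
  set_nbrs (multipartite phi) v (fun y => phi y != j) = multipartite (recolor phi v j).
Proof.
apply: eq_rel => x y; rewrite /set_nbrs /multipartite /recolor.
by have [xv|xv] := eqVneq x v; have [yv|yv] := eqVneq y v; rewrite ?eqxx //= eq_sym.
Qed.

Definition off_dist e f v : R := \sum_(x | x != v) \sum_(y | y != v) edge_diff R e f x y.

Lemma dist_split e f v : symmetric e -> symmetric f -> irreflexive e -> irreflexive f ->
  (dist e f)%:R = off_dist e f v + 2 * \sum_y edge_diff R e f v y.
Proof.
move=> es fs ei fi; rewrite distE (bigD1 v) //=.
have dvv : edge_diff R e f v v = 0 by rewrite /edge_diff ei fi eqxx.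
have dC x y : edge_diff R e f x y = edge_diff R e f y x by rewrite /edge_diff es fs.
have -> : \sum_(x | x != v) \sum_y edge_diff R e f x y = off_dist e f v + \sum_(x | x != v) edge_diff R e f v x.
  rewrite /off_dist -big_split; apply: eq_bigr => x _.
  by rewrite (bigD1 v) //= addrC dC.
by rewrite [\sum_y _](bigD1 v) //= dvv add0r; ring.
Qed.

Lemma off_dist_set_nbrs e f v g h :
  off_dist (set_nbrs e v g) (set_nbrs f v h) v = off_dist e f v.
Proof.
apply: eq_bigr => x /negPf xv; apply: eq_bigr => y /negPf yv.
by rewrite /edge_diff /set_nbrs xv yv.
Qed.

Lemma diff_set_nbrs e f v g h y :
  edge_diff R (set_nbrs e v g) (set_nbrs f v h) v y = ((y != v) && (g y != h y))%:R.
Proof. by rewrite /edge_diff /set_nbrs eqxx; case: (y == v). Qed.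

Lemma dist_set_nbrs e v g h : symmetric e -> irreflexive e ->
  (dist (set_nbrs e v g) (set_nbrs e v h))%:R = 2 * \sum_y ((y != v) && (g y != h y))%:R :> R.
Proof.
move=> es ei; rewrite (@dist_split _ _ v); try exact: set_nbrs_sym; try exact: set_nbrs_irr.
rewrite off_dist_set_nbrs /off_dist big1 ?add0r.
  by congr (_ * _); apply: eq_bigr => y _; rewrite diff_set_nbrs.
by move=> x _; apply: big1 => y _; rewrite /edge_diff eqxx.
Qed.

(** Transfers a gain from f to e: changing the neighbourhood of v from g to h has nearly the same
    effect in both graphs. The constant is 16 + 10 + 10. *)
Lemma star_count_second_diff e f v g h : 1 <= n ->
  symmetric e -> symmetric f -> irreflexive e -> irreflexive f ->
  star_count R (set_nbrs f v h) - star_count R (set_nbrs f v g) - 36 * n * (dist e f)%:R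
  <= star_count R (set_nbrs e v h) - star_count R (set_nbrs e v g).
Proof.
move=> n1 es fs ei fi.
have D k : (dist (set_nbrs e v k) (set_nbrs f v k))%:R <= (dist e f)%:R :> R.
  rewrite (@dist_split _ _ v); try exact: set_nbrs_sym; try exact: set_nbrs_irr.
  rewrite (@dist_split e f v) // off_dist_set_nbrs lerD2l ler_pM2l //.
  apply: ler_sum => y _; rewrite diff_set_nbrs eqxx andbF; exact: ler0n.
have hh : `|(hom_count R (set_nbrs e v h) - hom_count R (set_nbrs e v g))
   - (hom_count R (set_nbrs f v h) - hom_count R (set_nbrs f v g))|
   <= 16 * n * (dist (set_nbrs e v g) (set_nbrs f v g))%:R.
  apply: (@hom_count_second_diff R T v) => x y; rewrite /set_nbrs.
  - by move=> /negPf-> /negPf->.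
  - by move=> /negPf-> /negPf->.
  - by case: (x == v) => //= ->.
  - by case: (x == v) => //= ->.
have lg := lower_count_lipschitz (set_nbrs e v g) (set_nbrs f v g) n1.
have lh := lower_count_lipschitz (set_nbrs e v h) (set_nbrs f v h) n1.
have n0 : 0 <= n by rewrite ler0n.
have Dg := ler_wpM2l n0 (D g); have Dh := ler_wpM2l n0 (D h).
move: hh lg lh; rewrite !ler_norml !star_countE => /andP[a1 a2] /andP[a3 a4] /andP[a5 a6].
lra.
Qed.
End SetNeighbours.

(** Summing second differences of size at least K twice gives K s (s + 1)/2, here split between the
    two sides. *)
Lemma convex_growth (R : realFieldType) (a : nat -> R) (s : nat) (K : R) :
  (forall i, (1 <= i <= s)%N -> 2 * a i + K <= a i.+1 + a i.-1) ->
  a 1%N + s%:R * (a 1%N - a 0%N) + K * s%:R ^+ 2 / 2 <= a s.+1 - K * s%:R / 2.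
Proof.
move=> h.
have step k : (k <= s)%N -> a k + (a 1%N - a 0%N) + K * k%:R <= a k.+1.
  elim: k => [_|k IH ks]; first by rewrite mulr0; lra.
  have := h k.+1 ks; have := IH (ltnW ks); rewrite /= -[k.+1%:R]natr1; lra.
suff tot k : (k <= s)%N -> a 1%N + k%:R * (a 1%N - a 0%N) + K * k%:R ^+ 2 / 2 <= a k.+1 - K * k%:R / 2.
  exact: tot.
elim: k => [_|k IH ks]; first by rewrite /= !mulr0 !mul0r; lra.
have := step _ ks; have := IH (ltnW ks); rewrite -[k.+1%:R]natr1.
move: (k%:R : R) => m; lra.
Qed.

(** * Moving a vertex along a chain of clonings *)

Section MoveVertex.
Variables (R : rcfType) (T : finType) (phi : T -> 'I_5) (v : T) (g : pred T).
Local Notation n := (#|T|%:R : R).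
Hypotheses (n_large : 100 <= n) (phi_opt : near_optimal (part_ratio R phi)).

Let n_gt0 : 0 < n. Proof. by apply: lt_le_trans n_large. Qed.

Local Notation graph := (set_nbrs (multipartite phi) v g).

Section Chain.
Variable (j : 'I_5).
(** The vertices of [U] are twins of each other in the graph and not adjacent to v; [wrong] marks
    the vertices other than v on which v and a member of [U] disagree. *)
Let U := [set y | [&& y != v, phi y == j & ~~ g y]].
Let wrong c := (c != v) && (g c != (phi c != j)).
Variable u0 : T.
Hypothesis u0U : u0 \in U.

Let zs := v :: enum U.
Let s i x := if x \in take i zs then v else if x \in zs then u0 else x.
(* In E i the first i vertices of zs are clones of v and the others clones of u0.
   Each step of the chain is one cloning, so star_count is convex along it. *)
Let E i : rel T := relpre (s i) graph.

Let zs_uniq : uniq zs.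
Proof. by rewrite /= enum_uniq mem_enum inE eqxx. Qed.

Let size_zs : size zs = #|U|.+1. Proof. by rewrite /= -cardE. Qed.

Let u0v : u0 != v. Proof. by move: u0U; rewrite inE => /and3P[]. Qed.
Let u0j : phi u0 = j. Proof. by move: u0U; rewrite inE => /and3P[_ /eqP]. Qed.
Let u0g : g u0 = false. Proof. by move: u0U; rewrite inE => /and3P[_ _ /negPf]. Qed.

Let E0 : E 0 = multipartite (recolor phi v j).
Proof.
have sv x : s 0 x != v.
  rewrite /s take0 in_nil; case: ifP => // /negbT; rewrite inE negb_or => /andP[]//.
have sphi x : phi (s 0 x) = recolor phi v j x.
  rewrite /s take0 in_nil /recolor; have [->|xv] := eqVneq x v; first by rewrite mem_head.
  rewrite inE (negPf xv) mem_enum /=; case: ifP => // xU.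
  by move: xU; rewrite u0j inE => /and3P[_ /eqP ->].
apply: eq_rel => x y.
by rewrite /E /= /set_nbrs (negPf (sv x)) (negPf (sv y)) /multipartite !sphi.
Qed.

(** The only clone of v is v itself, and the vertices of [U] are twins of [u0] already, so nothing
    changes. *)
Let E1 : E 1 = graph.
Proof.
have sv x : (s 1 x == v) = (x == v).
  rewrite /s /= take0 inE; have [xv|xv] := eqVneq x v; first by rewrite eqxx.
  by case: ifP => _; [rewrite (negPf u0v) | rewrite (negPf xv)].
have sphi x : phi (s 1 x) = phi x.
  rewrite /s /= take0 inE; have [xv|xv] := eqVneq x v; first by rewrite xv.
  rewrite inE (negPf xv) mem_enum /=; case: ifP => // xU.
  by move: xU; rewrite u0j inE => /and3P[_ /eqP ->].
have sg x : x != v -> g (s 1 x) = g x.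
  move=> xv; rewrite /s /= take0 !inE (negPf xv) mem_enum /=; case: ifP => //.
  by rewrite u0g inE => /and3P[_ _ /negPf].
apply: eq_rel => x y; rewrite /E /= /set_nbrs !sv /multipartite !sphi.
have [xv|xv] := eqVneq x v; last by case: ifP => // _; exact: sg.
by have [yv|yv] := eqVneq y v => //=; exact: sg.
Qed.

Let E_sym i : symmetric (E i).
Proof. by move=> x y; rewrite /E /=; apply: set_nbrs_sym; exact: multipartite_sym. Qed.
Let E_irr i : irreflexive (E i).
Proof. by move=> x; rewrite /E /=; apply: set_nbrs_irr; exact: multipartite_irr. Qed.

(** Such a vertex is adjacent to everything outside v, its own part and part j. At most one of these
    parts is the large one, so together they hold at most 711/1000 of the vertices. *)
Let deg_E i c : c != v -> c \notin U -> n / 2 <= 2 * deg R (E i) c - 2.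
Proof.
move=> cv cU.
have cz : c \notin zs by rewrite inE negb_or cv mem_enum.
have sz x : x \notin zs -> s i x = x.
  move=> xz; rewrite /s (negPf xz) ifN //; apply: contra xz; exact: mem_take.
have h : \sum_x (1 - (phi x == phi c)%:R - (phi c != j)%:R * (phi x == j)%:R - (x == v)%:R) <= deg R (E i) c.
  apply: ler_sum => x _; have [xv|xv] := eqVneq x v.
    apply: (@le_trans _ _ 0); last exact: ler0n.
    by case: (phi x == phi c); case: (phi c == j); case: (phi x == j); rewrite /=; lra.
  have [xj|xj] := eqVneq (phi x) j.
    have [cj|cj] := eqVneq (phi c) j.
      by rewrite xj cj eqxx /= subrr !subr0 mul0r subr0; exact: ind_ge0.
    rewrite xj eq_sym (negPf cj) /= !subr0 mul1r subrr; exact: ind_ge0.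
  rewrite mulr0 !subr0 /edge_ind /E /= !sz //; last by rewrite inE (negPf xv) mem_enum inE (negPf xj) andbF.
  by rewrite /set_nbrs (negPf cv) (negPf xv) /multipartite eq_sym; case: eqP; rewrite /= ?subrr ?subr0.
have {h} : n - part_size R phi (phi c) - (phi c != j)%:R * part_size R phi j - 1 <= deg R (E i) c.
  apply: le_trans h; rewrite !sumrB -mulr_sumr sum_const mulr1 /part_size.
  have -> : \sum_x (x == v)%:R = 1 :> R; last by [].
  by rewrite (bigD1 v) //= eqxx big1 ?addr0 // => x /negPf ->.
rewrite !part_sizeE // => h.
have [j0 /andP[p1 p2] p3] := phi_opt.
have key : part_ratio R phi (phi c) + (phi c != j)%:R * part_ratio R phi j <= 711/1000.
  move: p2 p3 {h p1}; move: (part_ratio R phi) => r p2 p3.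
  have le_big k : r k <= 612/1000.
    by have [->|/p3/andP[_ ?]] := eqVneq k j0; first exact: p2; lra.
  have le_small k : k != j0 -> r k <= 985/1000/10 by move=> /p3/andP[].
  have [cj|cj] := eqVneq (phi c) j; first by rewrite mul0r; have := le_big (phi c); lra.
  rewrite mul1r; have [ej|/le_small] := eqVneq j j0; last by have := le_big (phi c); lra.
  by have := le_small (phi c); rewrite -ej => /(_ cj); have := le_big j; lra.
have := ler_wpM2l (ltW n_gt0) key; move: h n_large {key p1 p2 p3}.
move: (part_ratio _ _ _) (part_ratio _ _ _) (deg _ _ _) ((_ != _)%:R : R) n => r1 r2 d b m; lra.
Qed.

Let step i : (1 <= i <= #|U|)%N ->
  2 * star_count R (E i) + n / 2 * (\sum_c (wrong c)%:R) <= star_count R (E i.+1) + star_count R (E i.-1).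
Proof.
move=> /andP[i1 iU].
have iz : (i < size zs)%N by rewrite size_zs.
have i1z : (i.-1 < size zs)%N by apply: leq_ltn_trans iz; exact: leq_pred.
(* Here u is the first clone of [u0] and w the last clone of v in [zs]: cloning w at u moves up the
   chain, cloning u at w moves down. *)
pose u := nth v zs i; pose w := nth v zs i.-1.
have wi : w \in take i zs.
  by rewrite /w -[X in take X _](prednK i1) (take_nth v) // mem_rcons mem_head.
have ui : u \notin take i zs.
  have := zs_uniq; rewrite -{1}(cat_take_drop i zs) cat_uniq => /and3P[_ h _].
  apply: contra h => hu; apply/hasP; exists u => //.
  by rewrite (drop_nth v) // mem_head.
have uz : u \in zs by exact: mem_nth.
have wz : w \in zs by exact: mem_nth.
have wi1 : w \notin take i.-1 zs.
  have := zs_uniq; rewrite -{1}(cat_take_drop i.-1 zs) cat_uniq => /and3P[_ h _].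
  apply: contra h => hw; apply/hasP; exists w => //.
  by rewrite (drop_nth v) // mem_head.
have su : s i u = u0 by rewrite /s (negPf ui) uz.
have sw : s i w = v by rewrite /s wi.
have cu : clone (E i) u w = E i.+1.
  have es x : s i (redirect u w x) = s i.+1 x.
    rewrite /redirect /s (take_nth v) // mem_rcons inE -/u.
    by have [->|xu] := eqVneq x u; rewrite ?wi.
  by apply: eq_rel => x y; rewrite /clone /E /= !es.
have cw : clone (E i) w u = E i.-1.
  have es x : s i (redirect w u x) = s i.-1 x.
    rewrite /redirect; have [->|xw] := eqVneq x w.
      by rewrite su /s (negPf wi1) wz.
    rewrite /s; have -> : (x \in take i zs) = (x \in take i.-1 zs); last by [].
    by rewrite -{1}(prednK i1) (take_nth v) // mem_rcons inE -/w (negPf xw).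
  by apply: eq_rel => x y; rewrite /clone /E /= !es.
have uw : ~~ E i u w by rewrite /E /= su sw /set_nbrs (negPf u0v) eqxx u0g.
have := star_count_clone R (@E_sym i) (@E_irr i) uw; rewrite cu cw.
apply: le_trans; rewrite lerD2l mulr_sumr; apply: ler_sum => c _.
rewrite /wrong; have [->|cv] := eqVneq c v.
  rewrite /= mulr0; have -> : (E i v u != E i v w) = false; last by rewrite mul0r.
  have sv : s i v = v.
    by rewrite /s -(prednK i1) /= mem_head.
  by rewrite /E /= su sw sv /set_nbrs eqxx u0v u0g eqxx.
have [cU|cU] := boolP (c \in U).
  have : g c = (phi c != j) by move: cU; rewrite inE => /and3P[_ -> /negPf ->].
  move=> ->; rewrite eqxx mulr0.
  have [_|h] := eqVneq (E i c u) (E i c w); first by rewrite mul0r.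
  rewrite mul1r subr_ge0 -[leLHS]mulr1 ler_pM2l //.
  have [z ez] : exists z, E i c z.
    by move: h; case cu' : (E i c u); [exists u | case cw' : (E i c w) => //; exists w].
  rewrite /deg (bigD1 z) //= /edge_ind ez lerDl; apply: sumr_ge0 => y _; exact: ler0n.
have cz : c \notin zs by rewrite inE negb_or cv mem_enum.
have sc : s i c = c.
  rewrite /s (negPf cz) ifN //; apply: contra cz; exact: mem_take.
have -> : E i c u = (phi c != j).
  by rewrite /E /= su sc /set_nbrs (negPf cv) (negPf u0v) /multipartite u0j.
have -> : E i c w = g c.
  by rewrite /E /= sw sc /set_nbrs (negPf cv) eqxx.
rewrite /= eq_sym; case: (_ != _); last by rewrite mulr0 mul0r.
by rewrite mulr1 mul1r; exact: deg_E.
Qed.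

(** Convexity would lift the far end of the chain by gam n^2 |U|^2/4 above linear extrapolation, but
    that end is at most optimal. Half of this covers the available room tau n^4 + n^3; the other
    half, divided by |U|, is gained in the backward step from E 1 to E 0. *)
Lemma move_by_cloning (gam tau : R) :
  gam * n <= \sum_c (wrong c)%:R -> 0 <= gam ->
  opt_density R * n ^+ 4 - tau * n ^+ 4 <= star_count R graph ->
  tau * n ^+ 4 + n ^+ 3 <= gam * n ^+ 2 * #|U|%:R ^+ 2 / 8 ->
  star_count R graph + gam * n ^+ 2 * #|U|%:R / 8
    <= star_count R (multipartite (recolor phi v j)).
Proof.
move=> hg g0 hs ht.
have /= := @convex_growth R (fun i => star_count R (E i)) #|U| (gam * n ^+ 2 / 2).
rewrite E0 E1 => conv.
have {}conv := conv _.
have hstep i : (1 <= i <= #|U|)%N -> 2 * star_count R (E i) + gam * n ^+ 2 / 2 <= star_count R (E i.+1) + star_count R (E i.-1).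
  move=> /step; apply: le_trans; rewrite lerD2l.
  have n2 : 0 <= n / 2 by rewrite divr_ge0 // ltW.
  have := ler_wpM2l n2 hg; lra.
have {conv} := conv hstep.
have up := star_count_le_opt (@E_sym #|U|.+1) (@E_irr #|U|.+1) n_gt0.
have U1 : 1 <= #|U|%:R :> R by rewrite ler1n card_gt0; apply/set0Pn; exists u0.
move: (star_count R (E _)) (star_count R graph) (star_count R (multipartite _)) (opt_density R * _) up hs => A B C L up hs.
move: (#|U|%:R : R) U1 ht => m m1 ht conv.
have nn : 0 <= gam * n ^+ 2 by rewrite mulr_ge0 // exprn_ge0 // ltW.
have : m * (gam * n ^+ 2 * m / 8) <= m * (C - B).
  have : 0 <= gam * n ^+ 2 * m by rewrite mulr_ge0 //; lra.
  lra.
rewrite ler_pM2l; [lra | lra].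
Qed.
End Chain.
End MoveVertex.

(** * Moving a vertex joined to everything into a part *)

Section JoinPart.
Variables (R : rcfType) (T : finType) (phi : T -> 'I_5) (v : T) (j : 'I_5).
Local Notation n := (#|T|%:R : R).

Let size' k : R := \sum_(x | x != v) (phi x == k)%:R.
Let sq' : R := \sum_(x | x != v) size' (phi x).
(** A vertex adjacent to all others forms a sixth part, named [None], so the exact count of
    multipartite graphs applies. *)
Let isolate x := if x == v then None else Some (phi x).

Let isolateE : set_nbrs (multipartite phi) v xpredT = multipartite isolate.
Proof.
apply: eq_rel => x y; rewrite /set_nbrs /multipartite /isolate.
by have [xv|xv] := eqVneq x v; have [yv|yv] := eqVneq y v; rewrite ?xv ?yv ?eqxx.
Qed.

Let card_rest : \sum_(x | x != v) 1 = n - 1 :> R.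
Proof.
have : \sum_(x : T) 1 = n :> R by rewrite sum_const mulr1.
rewrite (bigD1 v) //= => <-; ring.
Qed.

Let size_phi k : part_size R phi k = size' k + (phi v == k)%:R.
Proof. by rewrite /part_size (bigD1 v) //= addrC. Qed.

Let size_recolor k : part_size R (recolor phi v j) k = size' k + (j == k)%:R.
Proof.
rewrite /part_size (bigD1 v) //= /recolor eqxx addrC; congr (_ + _).
by apply: eq_bigr => x /negPf ->.
Qed.

Let size_some k : part_size R isolate (Some k) = size' k.
Proof.
rewrite /part_size (bigD1 v) //= /isolate eqxx /= add0r.
by apply: eq_bigr => x /negPf ->.
Qed.

Let isolate_v : isolate v = None. Proof. by rewrite /isolate eqxx. Qed.
Let isolate_x x : x != v -> isolate x = Some (phi x).
Proof. by rewrite /isolate => /negPf ->. Qed.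
Let recolor_v : recolor phi v j v = j. Proof. by rewrite /recolor eqxx. Qed.
Let recolor_x x : x != v -> recolor phi v j x = phi x.
Proof. by rewrite /recolor => /negPf ->. Qed.

Let size_none : part_size R isolate None = 1.
Proof.
rewrite /part_size (bigD1 v) //= /isolate eqxx /= big1 ?addr0 //.
by move=> x /negPf ->.
Qed.

Let sq_isolate : part_sq R isolate = sq' + 1.
Proof.
rewrite /part_sq (bigD1 v) //= isolate_v size_none addrC; congr (_ + _).
by apply: eq_bigr => x /isolate_x ->.
Qed.

Let sum_eq k : \sum_(x | x != v) (k == phi x)%:R = size' k :> R.
Proof. by apply: eq_bigr => x _; rewrite eq_sym. Qed.

Let sq_phi : part_sq R phi = sq' + 2 * size' (phi v) + 1.
Proof.
rewrite /part_sq (bigD1 v) //= size_phi eqxx /=.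
rewrite (eq_bigr (fun x => size' (phi x) + (phi v == phi x)%:R)); last by move=> x _; rewrite size_phi.
by rewrite big_split /= sum_eq -/sq'; ring.
Qed.

Let sq_recolor : part_sq R (recolor phi v j) = sq' + 2 * size' j + 1.
Proof.
rewrite /part_sq (bigD1 v) //= recolor_v size_recolor eqxx /=.
rewrite (eq_bigr (fun x => size' (phi x) + (j == phi x)%:R)).
  by rewrite big_split /= sum_eq -/sq'; ring.
by move=> x /recolor_x ->; rewrite size_recolor.
Qed.

Lemma join_part_gain (y := size' j) (Q := sq' + 1) :
  star_count R (multipartite (recolor phi v j))
    - star_count R (set_nbrs (multipartite phi) v xpredT) =
  2 * y * n ^+ 2 - 4 * y * Q - 3 * n * y ^+ 2 + 4 * y ^+ 3 - 3 * n * y + 5 * y ^+ 2 + 3 * y.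
Proof.
rewrite isolateE !star_count_multipartite sq_isolate sq_recolor.
rewrite (bigD1 v) //= [\sum_x _ * _ in X in _ - X](bigD1 v) //=.
rewrite recolor_v isolate_v size_none size_recolor eqxx /=.
set A := \sum_(_ | _) _; set B := \sum_(_ | _) _.
(* For x other than v, the move raises [part_sq] by 2 y, and it raises the size of the part of x by
   1 if x lies in part j. *)
have -> : A = B - y * (Q - n - y ^+ 2 + y) + 2 * y * ((n - 1) * (n - 2) - sq' - y * (n - y - 2)).
  have -> : (n - 1) * (n - 2) - sq' - y * (n - y - 2) =
    \sum_(x | x != v) ((n - 2) - size' (phi x) - (phi x == j)%:R * (n - y - 2)).
    have -> : (n - 1) * (n - 2) = \sum_(x | x != v) (n - 2).
      by rewrite -card_rest mulr_suml; apply: eq_bigr => x _; rewrite mul1r.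
    by rewrite !sumrB -mulr_suml.
  have -> : y * (Q - n - y ^+ 2 + y) = \sum_(x | x != v) (phi x == j)%:R * (Q - n - y ^+ 2 + y).
    by rewrite -mulr_suml.
  rewrite [2 * y * _]mulr_sumr /A /B -sumrB -big_split; apply: eq_bigr => x xv /=.
  rewrite recolor_x // isolate_x // size_some size_recolor [j == _]eq_sym.
  by have [->|_] := eqVneq (phi x) j; rewrite -/y /Q /=; ring.
rewrite -/y /Q; ring.
Qed.

(** The leading gain is y (2 n^2 - 4 Q - 3 n y + 4 y^2). Up to lower order Q is at most y^2 +
    389/10000 n^2, which cancels the squares of y, and y <= 612/1000 n leaves at least 84/10000 n^2
    y. *)
Lemma join_big_part :
  1000 * 100 <= n ->
  609/1000 <= part_ratio R phi j <= 612/1000 ->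
  \sum_k part_ratio R phi k ^+ 2 - part_ratio R phi j ^+ 2 <= 389/100/100 ->
  star_count R (set_nbrs (multipartite phi) v xpredT) + 4/1000 * n ^+ 3
    <= star_count R (multipartite (recolor phi v j)).
Proof.
move=> n_large /andP[h1 h2] h3.
have n_gt0 : 0 < n by apply: lt_le_trans n_large; lra.
suff : 4/1000 * n ^+ 3 <= star_count R (multipartite (recolor phi v j))
    - star_count R (set_nbrs (multipartite phi) v xpredT) by lra.
rewrite join_part_gain.
have n2 : 0 <= n ^+ 2 by rewrite exprn_ge0 // ltW.
have hQ : sq' + 1 <= part_size R phi j ^+ 2 + 389/100/100 * n ^+ 2.
  have s0 : 0 <= size' (phi v) by apply: sumr_ge0 => x _; exact: ler0n.
  apply: (@le_trans _ _ (part_sq R phi)); first by rewrite sq_phi; lra.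
  have -> : part_sq R phi = n ^+ 2 * \sum_k part_ratio R phi k ^+ 2.
    by rewrite part_sqE mulr_sumr; apply: eq_bigr => k _; rewrite part_sizeE // exprMn.
  rewrite part_sizeE // exprMn; have := ler_wpM2l n2 h3; lra.
have e1 : part_size R phi j <= size' j + 1.
  by rewrite size_phi lerD2l; case: (_ == _).
have e2 : size' j <= part_size R phi j by rewrite size_phi lerDl; exact: ler0n.
have e3 : part_size R phi j <= 612/1000 * n.
  by rewrite part_sizeE // mulrC; apply: ler_wpM2r => //; exact: ltW.
have e4 : 609/1000 * n <= part_size R phi j.
  by rewrite part_sizeE // [leRHS]mulrC; apply: ler_wpM2r => //; exact: ltW.
move: (size' j) (sq' + 1) (part_size _ _ _) n n_gt0 n_large n2 hQ e1 e2 e3 e4 {h1 h2 h3} => y Q p m m0 m1 m2 hQ e1 e2 e3 e4.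
have y0 : 608/1000 * m <= y by lra.
have y1 : y <= 612/1000 * m by lra.
have yp : 0 <= y by lra.
have f1 : p ^+ 2 <= y ^+ 2 + 2 * y + 1 by nra.
have f2 : 4 * y * Q <= 4 * y * (y ^+ 2 + 2 * y + 1 + 389/100/100 * m ^+ 2).
  by apply: ler_wpM2l; lra.
have f3 : y * (84/100/100 * m ^+ 2) <= y * ((1 + 84/100 + 44/100/100) * m ^+ 2 - 3 * m * y).
  apply: ler_wpM2l => //.
  have := ler_wpM2l (ltW m0) y1; lra.
have f4 : 51/100/100 * m ^+ 3 <= y * (84/100/100 * m ^+ 2).
  have g1 := ler_wpM2r m2 y0; have g2 : 0 <= m * m ^+ 2 by rewrite mulr_ge0 // ltW.
  clear hQ e1 e2 e3 e4 f1 f2 f3; lra.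
clear hQ f1 e1 e2 e3 e4.
have f5 : 1000 * 100 * m ^+ 2 <= m ^+ 3 by have := ler_wpM2r m2 m1; lra.
have f6 : y * m <= m ^+ 2 by have := ler_wpM2r (ltW m0) y1; lra.
have f7 : y ^+ 2 <= m ^+ 2 by nra.
have f8 : y <= m ^+ 2 by nra.
have := sqr_ge0 y; lra.
Qed.
End JoinPart.

(** * Gains in a neighbourhood of the optimum *)

Section LocalGain.
Variables (R : rcfType) (T : finType).
Implicit Types (e : rel T) (phi : T -> 'I_5) (v : T) (g : pred T).
Local Notation n := (#|T|%:R : R).

(* Any sufficiently small constant would do. *)
Definition local_radius : R := 1/100/100/100/100/100/100/100/100.

(* Either v has many non-neighbours in some part, which can be cloned, or v is
   joined to almost everything and then it gains by joining the largest part. *)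
Lemma bad_vertex_gain phi v g :
  1 <= local_radius * n -> near_optimal (part_ratio R phi) ->
  (forall j, 1/1000 * n <= \sum_c ((c != v) && (g c != (phi c != j)))%:R) ->
  opt_density R * n ^+ 4 - 15 * local_radius * n ^+ 4 <= star_count R (set_nbrs (multipartite phi) v g) ->
  exists j, star_count R (set_nbrs (multipartite phi) v g) + 11/100/100/100/100/100 * n ^+ 3
    <= star_count R (multipartite (recolor phi v j)).
Proof.
move=> n_large phi_opt hw hs.
have n5 : 1000 * 100 <= n by move: n_large; rewrite /local_radius; lra.
have n100 : 100 <= n by apply: le_trans n5; lra.
have n1 : 1 <= n by apply: le_trans n100; lra.
have n0 : 0 < n by apply: lt_le_trans n1.
have n3 : 0 <= n ^+ 3 by rewrite exprn_ge0 // ltW.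
pose U j := [set y | [&& y != v, phi y == j & ~~ g y]].
case: (pselect (exists j, n/1000/100 <= #|U j|%:R)) => [[j hU]|none].
  exists j.
  have [u0 u0U] : exists u0, u0 \in U j.
    apply/set0Pn; rewrite -card_gt0 -(ltr0n R); apply: lt_le_trans hU.
    apply: divr_gt0; last exact: ltr0Sn.
    by apply: divr_gt0; [exact: n0 | exact: ltr0Sn].
  have g0 : 0 <= 1/1000 :> R by lra.
  have m0 : 0 <= n/1000/100 by rewrite !divr_ge0 // ltW.
  have sq : n ^+ 2 * (n/1000/100) ^+ 2 <= n ^+ 2 * #|U j|%:R ^+ 2.
    by rewrite ler_wpM2l ?exprn_ge0 ?(ltW n0) // lerXn2r // nnegrE ?ler0n.
  have t4 : n ^+ 3 <= local_radius * n ^+ 4.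
    by have := ler_wpM2r n3 n_large; rewrite mul1r; have -> : local_radius * n * n ^+ 3 = local_radius * n ^+ 4 by ring.
  have n4 : 0 <= n ^+ 4 by rewrite exprn_ge0 // ltW.
  have ht : 15 * local_radius * n ^+ 4 + n ^+ 3 <= 1/1000 * n ^+ 2 * #|U j|%:R ^+ 2 / 8.
    move: sq t4 n4; have -> : n ^+ 2 * (n/1000/100) ^+ 2 = n ^+ 4 / (1000 * 100) ^+ 2 by field.
    have -> : 1/1000 * n ^+ 2 * #|U j|%:R ^+ 2 / 8 = (1/1000/8) * (n ^+ 2 * #|U j|%:R ^+ 2) by ring.
    move: (n ^+ 2 * _) (n ^+ 4) (n ^+ 3) => A B C; rewrite /local_radius {n_large hw hs n5 n100 n1 n0 n3 hU g0 m0}.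
    lra.
  (* With |U| >= n/10^5 this gains n^3/(8 * 10^8), just above the claimed 11/10^10 n^3. *)
  apply: le_trans (move_by_cloning n100 phi_opt u0U (hw j) g0 hs ht).
  rewrite lerD2l.
  have sq1 : n ^+ 2 * (n/1000/100) <= n ^+ 2 * #|U j|%:R.
    by rewrite ler_wpM2l ?exprn_ge0 ?(ltW n0).
  move: sq1; have -> : n ^+ 2 * (n/1000/100) = n ^+ 3 / (1000 * 100) by field.
  have -> : 1/1000 * n ^+ 2 * #|U j|%:R / 8 = (1/1000/8) * (n ^+ 2 * #|U j|%:R) by ring.
  move: (n ^+ 2 * _) n3; clear -n0; move: (n ^+ 3) => A B; lra.
(* Now v misses at most 5 n/10^5 vertices. Joining it to them costs at most 28 * 5/10^5 n^3, less
   than the 4/1000 n^3 gained by [join_big_part]. *)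
have few : \sum_y ((y != v) && ~~ g y)%:R <= 5 * (n/1000/100).
  have -> : \sum_y ((y != v) && ~~ g y)%:R = \sum_j #|U j|%:R :> R.
    rewrite -natr_sum (partition_big phi predT) //= natr_sum; apply: eq_bigr => j _.
    rewrite -sum1_card !natr_sum big_mkcond [RHS]big_mkcond /=; apply: eq_bigr => y _.
    by rewrite inE; case: (y != v); case: (phi y == j); case: (g y).
  have -> : 5 * (n/1000/100) = \sum_(j < 5) (n/1000/100) by rewrite sumr_const card_ord mulr_natl.
  apply: ler_sum => j _; rewrite leNgt; apply/negP => h; apply: none; exists j; exact: ltW.
have [j0 [hj0 _ /andP[_ hj0']]] := near_optimal_sq phi_opt.
exists j0.
have join := join_big_part v n5 hj0 hj0'.
have := star_count_lipschitz (set_nbrs (multipartite phi) v g) (set_nbrs (multipartite phi) v xpredT) n1.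
rewrite dist_set_nbrs; [|exact: multipartite_sym|exact: multipartite_irr].
have -> : \sum_y ((y != v) && (g y != xpredT y))%:R = \sum_y ((y != v) && ~~ g y)%:R :> R.
  by apply: eq_bigr => y _; case: (g y).
rewrite ler_norml => /andP[_ lip].
have n2 : 0 <= n ^+ 2 by rewrite exprn_ge0 // ltW.
have f := ler_wpM2l n2 few.
have e3 : n ^+ 2 * (5 * (n/1000/100)) = 5 * n ^+ 3 / (1000 * 100) by field.
rewrite e3 in f; move: f lip join n3.
move: (star_count R (multipartite _)) (star_count R (set_nbrs _ _ xpredT)) (star_count R (set_nbrs _ _ g)) => A B C.
have -> : 14 * n ^+ 2 * (2 * \sum_y ((y != v) && ~~ g y)%:R) = 28 * (n ^+ 2 * \sum_y ((y != v) && ~~ g y)%:R) by ring.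
move: (n ^+ 2 * _) (n ^+ 3) => D E; clear -n0; lra.
Qed.
Lemma best_coloring e : exists phi : T -> 'I_5,
  forall psi : T -> 'I_5, (dist e (multipartite phi) <= dist e (multipartite psi))%N.
Proof.
pose F (p : {ffun T -> 'I_5}) := dist e (multipartite p).
case: (@arg_minnP _ [ffun=> ord0] xpredT F isT) => p _ pmin; exists p => psi.
have := pmin (finfun psi) isT; rewrite /F.
suff -> : multipartite (finfun psi) = multipartite psi by [].
by apply: eq_rel => x y; rewrite /multipartite !ffunE.
Qed.

Lemma dist_triangle e f h : (dist e h <= dist e f + dist f h)%N.
Proof.
rewrite /dist -big_split; apply: leq_sum => x _; rewrite -big_split; apply: leq_sum => y _ /=.
by case: (e x y); case: (f x y); case: (h x y).
Qed.

(** The Lipschitz bound costs 14 [local_radius]; the total of 15 [local_radius] is below the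
    tolerance 1/10^14 of [near_optimal_of_density]. *)
Lemma near_optimal_of_dist e phi : 1 <= n ->
  opt_density R * n ^+ 4 - local_radius * n ^+ 4 <= star_count R e ->
  (dist e (multipartite phi))%:R <= local_radius * n ^+ 2 ->
  near_optimal (part_ratio R phi).
Proof.
move=> n1 hs hd.
have n0 : 0 < n by apply: lt_le_trans n1.
apply: near_optimal_of_density; [exact: part_ratio_ge0 | exact: sum_part_ratio |].
have := star_count_lipschitz e (multipartite phi) n1.
rewrite ler_norml => /andP[_ lip].
have n2 : 0 <= n ^+ 2 by rewrite exprn_ge0 // ltW.
have hd2 := ler_wpM2l n2 hd.
have up := star_count_multipartite_le phi n0.
have n4 : 0 < n ^+ 4 by rewrite exprn_gt0.
rewrite -(ler_pM2l n4); apply: le_trans up.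
have e4 : n ^+ 2 * (local_radius * n ^+ 2) = local_radius * n ^+ 4 by ring.
rewrite e4 in hd2.
move: hs lip hd2 n4; rewrite mulrDr [_ * opt_density R]mulrC.
move: (opt_density R * _) (star_count R e) (star_count R _) => A B C.
have -> : 14 * n ^+ 2 * (dist e (multipartite phi))%:R = 14 * (n ^+ 2 * (dist e (multipartite phi))%:R) by ring.
move: (n ^+ 2 * _) (n ^+ 4) {n0 n1 n2 hd} => D E; rewrite /local_radius; lra.
Qed.

(* While some vertex has many wrong pairs, it is moved to another part, gaining
   a cubic amount; when no such vertex is left, all wrong pairs are flipped. *)
Lemma local_gain k e phi : symmetric e -> irreflexive e -> 1 <= local_radius * n ->
  (dist e (multipartite phi) <= k)%N ->
  (forall psi : T -> 'I_5, (dist e (multipartite phi) <= dist e (multipartite psi))%N) ->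
  opt_density R * n ^+ 4 - local_radius * n ^+ 4 <= star_count R e ->
  (dist e (multipartite phi))%:R <= local_radius * n ^+ 2 ->
  exists e', [/\ symmetric e', irreflexive e' &
    star_count R e + 1/100/100/100/100/100 * n ^+ 2 * (dist e (multipartite phi))%:R <= star_count R e'].
Proof.
move=> + + n_large.
have n5 : 1000 * 100 <= n by move: n_large; rewrite /local_radius; lra.
have n1 : 1 <= n by apply: le_trans n5; lra.
have n0 : 0 < n by apply: lt_le_trans n1.
have n2 : 0 <= n ^+ 2 by rewrite exprn_ge0 // ltW.
have n3 : 0 <= n ^+ 3 by rewrite exprn_ge0 // ltW.
elim: k e phi => [|k IH] e phi es ei hk hmin hs hd.
  by exists e; split => //; move: hk; rewrite leqn0 => /eqP ->; rewrite mulr0 addr0.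
have phi_opt := near_optimal_of_dist n1 hs hd.
case: (pselect (exists v, 1/1000 * n < \sum_y edge_diff R e (multipartite phi) v y)); last first.
  move=> none; exists (multipartite phi); split; [exact: multipartite_sym | exact: multipartite_irr |].
  have row x : \sum_y edge_diff R e (multipartite phi) x y <= 1/1000 * n.
    by rewrite leNgt; apply/negP => h; apply: none; exists x.
  have hd' : (dist e (multipartite phi))%:R <= 1/1000 * n ^+ 2.
    apply: le_trans hd _; apply: ler_wpM2r => //; rewrite /local_radius {n_large hs n5 n1 n0 n2 n3}; lra.
  have n1000 : 1000 <= n by apply: le_trans n5; lra.
  apply: le_trans (small_degree_errors es n1 phi_opt row hd' n1000).
  rewrite lerD2l -[leLHS]mulrA -[leRHS]mulrA; apply: ler_wpM2r; first by rewrite mulr_ge0.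
  clear; lra.
move=> [v hv].
pose f := multipartite phi; pose g := e v.
have fs : symmetric f := multipartite_sym phi.
have fi : irreflexive f := multipartite_irr phi.
have eE : set_nbrs e v g = e by exact: set_nbrs_id.
pose F j := set_nbrs e v (fun y => phi y != j).
have FE j : (dist (F j) (multipartite (recolor phi v j)))%:R = off_dist R e f v.
  rewrite -set_nbrs_multipartite (@dist_split _ _ _ _ v); try exact: set_nbrs_sym; try exact: set_nbrs_irr.
  rewrite off_dist_set_nbrs big1 ?mulr0 ?addr0 // => y _.
  by rewrite diff_set_nbrs eqxx andbF.
have eD : (dist e f)%:R = off_dist R e f v + 2 * \sum_y edge_diff R e f v y by exact: dist_split.
(* Recolouring v by j does not reduce the distance, so v has at least as many wrong pairs with
   respect to part j as under phi. *)
have wrong j : 1/1000 * n <= \sum_c ((c != v) && (g c != (phi c != j)))%:R.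
  have := hmin (recolor phi v j); rewrite -(ler_nat R) -/f eD -set_nbrs_multipartite -[in leRHS]eE.
  rewrite (@dist_split _ _ (set_nbrs e v g) _ v); try exact: set_nbrs_sym; try exact: set_nbrs_irr.
  rewrite off_dist_set_nbrs lerD2l ler_pM2l //; move=> h.
  apply: le_trans (ltW hv) (le_trans h _); rewrite le_eqVlt; apply/orP; left; apply/eqP.
  by apply: eq_bigr => y _; rewrite diff_set_nbrs.
(* The graph [set_nbrs f v g] is multipartite except that v keeps its neighbourhood in e; it is no
   farther from e than f is. *)
have dnear : (dist e (set_nbrs f v g))%:R <= (dist e f)%:R :> R.
  rewrite -{1}eE (@dist_split _ _ (set_nbrs e v g) _ v); try exact: set_nbrs_sym; try exact: set_nbrs_irr.
  rewrite off_dist_set_nbrs eD lerD2l ler_pM2l //.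
  by apply: ler_sum => y _; rewrite diff_set_nbrs eqxx andbF; exact: ler0n.
have hs' : opt_density R * n ^+ 4 - 15 * local_radius * n ^+ 4 <= star_count R (set_nbrs f v g).
  have := star_count_lipschitz e (set_nbrs f v g) n1.
  rewrite ler_norml => /andP[_ lip].
  have h1 : 14 * n ^+ 2 * (dist e (set_nbrs f v g))%:R <= 14 * local_radius * n ^+ 4.
    have -> : 14 * local_radius * n ^+ 4 = 14 * n ^+ 2 * (local_radius * n ^+ 2) by ring.
    by apply: ler_wpM2l; [rewrite mulr_ge0 | exact: le_trans dnear hd].
  move: lip h1 hs; move: (opt_density R * n ^+ 4) (star_count R e) (star_count R _) (14 * n ^+ 2 * _) => A B C D.
  move: (n ^+ 4) local_radius => E t; clear; lra.
have [j hj] := bad_vertex_gain n_large phi_opt wrong hs'.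
(* The gain found in the multipartite graph carries over to e up to 36 [local_radius] n^3, which is
   negligible. *)
have sd := star_count_second_diff v g (fun y => phi y != j) n1 es fs ei fi.
rewrite eE -/(F j) set_nbrs_multipartite in sd.
have gain : star_count R e + 1/100/100/100/100/10 * n ^+ 3 <= star_count R (F j).
  have h1 : n * (dist e f)%:R <= local_radius * n ^+ 3.
    have -> : local_radius * n ^+ 3 = n * (local_radius * n ^+ 2) by ring.
    by apply: ler_wpM2l => //; exact: ltW.
  move: hj sd h1 n3.
  have -> : 36 * n * (dist e f)%:R = 36 * (n * (dist e f)%:R) by ring.
  move: (star_count R e) (star_count R (F j)) (star_count R (set_nbrs _ _ _)) (star_count R _) (n * _) (n ^+ 3).
  move=> A B C D E G; rewrite /local_radius; clear; lra.
have Fs : symmetric (F j) by exact: set_nbrs_sym.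
have Fi : irreflexive (F j) by exact: set_nbrs_irr.
have [phi2 min2] := best_coloring (F j).
have rpos : 0 < \sum_y edge_diff R e f v y by apply: le_lt_trans hv; rewrite mulr_ge0 ?(ltW n0) ?divr_ge0.
have d2 : (dist (F j) (multipartite phi2))%:R <= off_dist R e f v.
  by rewrite -(FE j) ler_nat.
have d2lt : (dist (F j) (multipartite phi2) < dist e f)%N.
  by rewrite -(ltr_nat R) eD; apply: le_lt_trans d2 _; rewrite ltrDl mulr_gt0.
have k2 : (dist (F j) (multipartite phi2) <= k)%N by rewrite -ltnS; exact: leq_trans d2lt hk.
have hs2 : opt_density R * n ^+ 4 - local_radius * n ^+ 4 <= star_count R (F j).
  apply: le_trans hs (le_trans _ gain); rewrite lerDl.
  by rewrite mulr_ge0 // !divr_ge0.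
have hd2 : (dist (F j) (multipartite phi2))%:R <= local_radius * n ^+ 2.
  by apply: le_trans hd; rewrite ler_nat ltnW.
have [e' [e's e'i he']] := IH _ _ Fs Fi k2 min2 hs2 hd2.
exists e'; split => //; apply: le_trans he'.
(* One move changes the distance by at most 2 n, so its cubic gain also pays for the wrong pairs
   that it removes. *)
have dd : (dist e f)%:R <= 2 * n + (dist (F j) (multipartite phi2))%:R :> R.
  apply: (@le_trans _ _ ((dist e (F j))%:R + (dist (F j) (multipartite phi2))%:R)).
    rewrite -natrD ler_nat; apply: leq_trans (hmin phi2) _; exact: dist_triangle.
  rewrite lerD2r -{1}eE dist_set_nbrs // ler_pM2l //.
  rewrite -[n]mulr1 -sum_const; apply: ler_sum => y _; by case: (_ && _).
have := ler_wpM2l n2 dd; move: gain n3; rewrite -/f.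
have -> : n ^+ 2 * (2 * n + (dist (F j) (multipartite phi2))%:R) = 2 * n ^+ 3 + n ^+ 2 * (dist (F j) (multipartite phi2))%:R by ring.
move: (star_count R e) (star_count R (F j)) (dist e f)%:R (dist (F j) _)%:R n => A B C D m.
clear; lra.
Qed.
End LocalGain.

(** * From near-optimal to nearly 5-partite *)

Section WeakStability.
Variables (R : rcfType) (T : finType).
Implicit Types (e : rel T) (u v x y : T).
Local Notation n := (#|T|%:R : R).
Local Notation tiny := (local_radius R).

(** A quarter of the tolerance of [partite_density_stable] at eta = [local_radius] / 10, leaving
    room for terms of order n^3. *)
Definition deficit_threshold : R := (tiny / 10) ^+ 2 / 1000 / 1000 / 100 / 4.

Lemma dist_clone e u v : (dist e (clone e u v))%:R <= 2 * n.
Proof.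
have h x y : edge_diff R e (clone e u v) x y <= (x == u)%:R + (y == u)%:R.
  rewrite /edge_diff /clone /= /redirect.
  have b01 (b : bool) : b%:R <= 1 :> R by case: b.
  case: (x == u); case: (y == u); try (apply: le_trans (b01 _) _; rewrite /=; lra).
  by rewrite eqxx addr0.
rewrite distE; apply: le_trans (ler_sum _ (fun x _ => ler_sum _ (fun y _ => h x y))) _.
have s : \sum_x (x == u)%:R = 1 :> R.
  by rewrite (bigD1 u) //= eqxx big1 ?addr0 // => x /negPf ->.
under eq_bigr => x _ do rewrite big_split /= sum_const s.
by rewrite big_split /= -mulr_sumr s sum_const; lra.
Qed.

Lemma local_radius_gt0 : 0 < tiny. Proof. by rewrite /local_radius !divr_gt0. Qed.

Lemma deficit_threshold_gt0 : 0 < deficit_threshold.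
Proof. by rewrite /deficit_threshold !divr_gt0 // exprn_gt0 // divr_gt0 // local_radius_gt0. Qed.

Lemma deficit_threshold_le : 1000 * deficit_threshold <= 1/100/100/100/100/100 * tiny.
Proof.
have t0 := local_radius_gt0.
have t1 : tiny <= 1/100/100/100/100/100 by rewrite /local_radius; lra.
rewrite /deficit_threshold; move: tiny t0 t1 => t t0 t1; nra.
Qed.

Lemma coarsen (I : finType) (psi : T -> I) i0 (P : {set I}) eta : 0 < n ->
  i0 \notin P -> #|P| = 4%N ->
  1 - eta <= part_ratio R psi i0 + \sum_(i in P) part_ratio R psi i ->
  exists phi : T -> 'I_5,
    (dist (multipartite psi) (multipartite phi))%:R <= 2 * eta * n ^+ 2.
Proof.
move=> n0 hi0 P4 hsum.
pose L := i0 :: enum P.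
have sL : size L = 5%N by rewrite /= -cardE P4.
(* A vertex outside the five listed parts has index 5, which [inord] sends to colour 0; only pairs
   with such a vertex can change. *)
exists (fun x => inord (index (psi x) L)).
pose out x : R := (psi x \notin L)%:R.
have h x y : edge_diff R (multipartite psi) (multipartite (fun x => inord (index (psi x) L) : 'I_5)) x y
    <= out x + out y.
  have b01 (b : bool) : b%:R <= 1 :> R by case: b.
  rewrite /edge_diff /out /multipartite.
  have [xL|xL] := boolP (psi x \in L); last first.
    by apply: (@le_trans _ _ 1); [exact: b01 | rewrite lerDl ler0n].
  have [yL|yL] := boolP (psi y \in L); last first.
    by apply: (@le_trans _ _ 1); [exact: b01 | rewrite lerDr ler0n].
  have ix : (index (psi x) L < 5)%N by rewrite -sL index_mem.
  have iy : (index (psi y) L < 5)%N by rewrite -sL index_mem.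
  rewrite -val_eqE /= !inordK //.
  have -> : (index (psi x) L == index (psi y) L) = (psi x == psi y); last by rewrite eqxx addr0.
  apply/eqP/eqP => [E|->] //.
  by rewrite -(nth_index i0 xL) -(nth_index i0 yL) E.
rewrite distE; apply: le_trans (ler_sum _ (fun x _ => ler_sum _ (fun y _ => h x y))) _.
under eq_bigr => x _ do rewrite big_split /= sum_const.
rewrite big_split /= -mulr_sumr sum_const.
suff : \sum_x out x <= eta * n.
  by move/(ler_wpM2l (ltW n0)); move: (\sum_x _) n => S m; lra.
have -> : \sum_x out x = n - \sum_(i <- L) part_size R psi i.
  rewrite exchange_big /= -[n]mulr1 -sum_const -sumrB; apply: eq_bigr => x _.
  rewrite /out; have [xL|xL] := boolP (psi x \in L).
    have uL : uniq L by rewrite /= enum_uniq mem_enum hi0.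
    rewrite (bigD1_seq (psi x)) //= eqxx big1 ?addr0 ?subrr // => i /negPf.
    by rewrite eq_sym => ->.
  rewrite big_seq big1 ?subr0 // => i iL.
  by case: eqP => // E; rewrite E iL in xL.
have -> : \sum_(i <- L) part_size R psi i = n * (part_ratio R psi i0 + \sum_(i in P) part_ratio R psi i).
  rewrite big_cons big_enum_cond mulrDr mulr_sumr -part_sizeE //; congr (_ + _).
  by apply: eq_big => [i|i _]; rewrite ?andbT // part_sizeE.
have := ler_wpM2l (ltW n0) hsum; lra.
Qed.

(* A maximal graph among those far from 5-partite is complete multipartite: a
   cloning cannot jump over the distances that local_gain excludes. *)
Lemma close_to_partite e : symmetric e -> irreflexive e -> 1 <= deficit_threshold * n ->
  opt_density R * n ^+ 4 - deficit_threshold * n ^+ 4 <= star_count R e ->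
  exists phi : T -> 'I_5, (dist e (multipartite phi))%:R <= tiny * n ^+ 2.
Proof.
move=> es ei n_large hs; apply: contrapT => far.
pose is_far f := forall phi : T -> 'I_5, tiny * n ^+ 2 < (dist f (multipartite phi))%:R.
have far_e : is_far e.
  by move=> phi; rewrite ltNge; apply/negP => h; apply: far; exists phi.
have [f [fs fi farf fmax]] := graph_argmax (@augmented_count R T) es ei far_e.
have t0 := local_radius_gt0; have t20 := deficit_threshold_gt0; have t2 := deficit_threshold_le.
have t1 : tiny <= 1/100/100/100/100/100 by rewrite /local_radius; lra.
have nt : 1 <= tiny * n / 1000.
  have n0' : 0 <= n by rewrite ler0n.
  have h : 1000 * deficit_threshold <= tiny by move: tiny t0 t2 => t; lra.
  by have := ler_wpM2r n0' h; lra.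
have n0 : 0 < n by rewrite -(pmulr_rgt0 _ t20); apply: lt_le_trans n_large.
have n1 : 1 <= n.
  by have := ler_wpM2r (ltW n0) t1; move: n tiny nt n0 {hs far_e n_large} => m t; lra.
have n2 : 0 < n ^+ 2 by rewrite exprn_gt0.
have n3 : 0 < n ^+ 3 by rewrite exprn_gt0.
have n34 : n ^+ 3 <= deficit_threshold * n ^+ 4.
  by have := ler_wpM2r (ltW n3) n_large; rewrite mul1r -mulrA -exprS.
have sf : opt_density R * n ^+ 4 - deficit_threshold * n ^+ 4 <= augmented_count R f.
  apply: le_trans hs (le_trans _ (fmax e es ei far_e)).
  by rewrite /augmented_count lerDl; exact: deg_sq_ge0.
have aug_star (h : rel T) : augmented_count R h <= star_count R h + n ^+ 3.
  by rewrite /augmented_count lerD2l; exact: deg_sq_le.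
have n4 : 0 < n ^+ 4 by rewrite exprn_gt0.
have tw u v : ~~ f u v -> f u =1 f v.
  move=> uv; apply: contrapT => ntw.
  (* If the augmented count increased, maximality would make the clone close to 5-partite. *)
  have bad a b : ~~ f a b -> ~ (augmented_count R f < augmented_count R (clone f a b)).
    move=> ab lt; set h := clone f a b in lt.
    have hsym : symmetric h by exact: clone_sym.
    have hirr : irreflexive h by exact: clone_irr.
    have [phi hphi] : exists phi : T -> 'I_5, (dist h (multipartite phi))%:R <= tiny * n ^+ 2.
      apply: contrapT => farh; move: lt; rewrite ltNge fmax //.
      by move=> phi; rewrite ltNge; apply/negP => ?; apply: farh; exists phi.
    have [phi0 min0] := best_coloring h.
    have hphi0 : (dist h (multipartite phi0))%:R <= tiny * n ^+ 2.
      by apply: le_trans hphi; rewrite ler_nat.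
    have sh : opt_density R * n ^+ 4 - 2 * (deficit_threshold * n ^+ 4) <= star_count R h.
      have := aug_star h; move: sf lt n34.
      move: (opt_density R * _) (augmented_count R f) (augmented_count R h) (star_count R h).
      by move: (deficit_threshold * _) (n ^+ 3) => A B C D E F; lra.
    have t24 : 1000 * (deficit_threshold * n ^+ 4) <= 1/100/100/100/100/100 * (tiny * n ^+ 4).
      by have := ler_wpM2r (ltW n4) t2; rewrite -!mulrA.
    have tn4 : 0 <= tiny * n ^+ 4 by rewrite mulr_ge0 ?ltW.
    have sh' : opt_density R * n ^+ 4 - tiny * n ^+ 4 <= star_count R h.
      apply: le_trans sh; move: t24 tn4; move: (opt_density R * _) (deficit_threshold * _) (tiny * _) => A B C; lra.
    have n_t : 1 <= tiny * n by move: nt; move: (tiny * n) => m; lra.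
    have [k [ks ki hk]] := local_gain hsym hirr n_t (leqnn _) min0 sh' hphi0.
    have up := star_count_le_opt ks ki n0.
    (* The gain of [local_gain] is limited by the small deficit of h, so h is within half the
       radius. Since f is within 2 n of h, f would be close as well. *)
    have d1 : 2 * n ^+ 2 * (dist h (multipartite phi0))%:R <= tiny * n ^+ 4.
      move: hk up sh t24 n34.
      move: (opt_density R * _) (star_count R h) (star_count R k) => A B C.
      have -> : 1 / 100 / 100 / 100 / 100 / 100 * n ^+ 2 * (dist h (multipartite phi0))%:R = 
        1 / 100 / 100 / 100 / 100 / 100 * (n ^+ 2 * (dist h (multipartite phi0))%:R) by ring.
      have -> : 2 * n ^+ 2 * (dist h (multipartite phi0))%:R = 2 * (n ^+ 2 * (dist h (multipartite phi0))%:R) by ring.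
      move: tn4; move: (n ^+ 2 * _) (deficit_threshold * _) (tiny * _) (n ^+ 3) => D E F G.
      by clear; lra.
    have d2 : 2 * (dist h (multipartite phi0))%:R <= tiny * n ^+ 2.
      rewrite -(ler_pM2l n2); apply: le_trans (_ : tiny * n ^+ 4 <= _); first by apply: le_trans d1; lra.
      by rewrite le_eqVlt; apply/orP; left; apply/eqP; ring.
    have := farf phi0; rewrite ltNge => /negP; apply.
    apply: le_trans (_ : (dist f h)%:R + (dist h (multipartite phi0))%:R <= _).
      by rewrite -natrD ler_nat; exact: dist_triangle.
    have := dist_clone f a b; rewrite -/h.
    have : 1000 * n <= tiny * n ^+ 2.
      by have := ler_wpM2r (ltW n0) nt; rewrite mul1r; lra.
    move: d2 n0; move: (dist f h)%:R (dist h _)%:R n (tiny * _) => A B C D; clear; lra.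
  have vu : ~~ f v u by rewrite fs.
  by have [/(bad _ _ uv)|/(bad _ _ vu)] := clone_increases R fs fi uv ntw.
have fE := eq_rel (multipartite_of_twins fs fi tw).
set psi := (fun x => _) in fE.
have e0 : 0 < tiny / 10 by rewrite divr_gt0.
have e1 : tiny / 10 <= 1 by move: tiny t1 => t; lra.
have hd : opt_density R - (tiny / 10) ^+ 2 / 1000 / 1000 / 100 <= partite_density (part_ratio R psi).
  have up := star_count_multipartite_le psi n0; rewrite -fE in up.
  rewrite -(ler_pM2l n4) mulrBr [_ * opt_density R]mulrC; have h := aug_star f.
  have -> : n ^+ 4 * ((tiny / 10) ^+ 2 / 1000 / 1000 / 100) = 4 * (deficit_threshold * n ^+ 4).
    by rewrite /deficit_threshold; field.
  move: h up sf n34; move: (opt_density R * _) (augmented_count R f) (star_count R f) (n ^+ 4 * _) => A B C D.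
  have : 0 <= deficit_threshold * n ^+ 4 by rewrite mulr_ge0 ?ltW.
  by move: (deficit_threshold * _) (n ^+ 3) => E F; lra.
have [i0 [P [hi0 P4 hb hsm]]] := partite_density_stable (part_ratio_ge0 R psi) (sum_part_ratio psi n0) e0 e1 hd.
(* Each of the five ratios is off by at most [local_radius] / 10, so the other parts hold at most
   half of [local_radius]; [coarsen] doubles this. *)
have hsum : 1 - tiny / 2 <= part_ratio R psi i0 + \sum_(i in P) part_ratio R psi i.
  have : \sum_(i in P) (small_part R - tiny / 10) <= \sum_(i in P) part_ratio R psi i.
    apply: ler_sum => i /hsm; rewrite ler_norml => /andP[h _]; lra.
  rewrite sumr_const P4 -mulr_natl; move: hb; rewrite ler_norml => /andP[h _].
  rewrite /small_part; move: (\sum_(i in P) _) (part_ratio R psi i0) (big_part R) h.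
  by move: tiny => t A B s h; lra.
have [phi hphi] := coarsen n0 hi0 P4 hsum.
have := farf phi; rewrite ltNge fE => /negP; apply.
by apply: le_trans hphi _; lra.
Qed.
End WeakStability.

(* Imported late because its hints make numerical side conditions above diverge. *)
From mathcomp Require Import all_classical all_reals all_analysis.
Import numFieldNormedType.Exports.
Local Open Scope classical_set_scope.
Local Open Scope ring_scope.

(** * Graphs on ordinals and embeddings *)

Section NearOptimalGraph.
Variables (R : realType) (n k : nat).
Hypothesis kn : (4 * k <= n)%N.

Definition threshold_coloring (i : 'I_n) : 'I_5 :=
  inord (if i < k then 1 else if i < 2 * k then 2 else if i < 3 * k then 3
         else if i < 4 * k then 4 else 0)%N.

Lemma sum_interval a b : (a <= b <= n)%N ->
  \sum_(i < n) ((a <= i) && (i < b))%N%:R = b%:R - a%:R :> R.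
Proof.
move=> /andP[ab bn]; rewrite -natrB // -natr_sum; congr (_%:R).
rewrite -(big_mkord xpredT (fun i => ((a <= i) && (i < b) : nat)%N)).
rewrite (@big_cat_nat _ _ _ a) //=; last exact: leq_trans ab bn.
rewrite (@big_cat_nat _ _ _ b a n) //=.
rewrite big_nat big1 ?add0n => [|i /andP[_ ia]]; last by rewrite leqNgt ia.
rewrite [X in (_ + X)%N]big_nat [X in (_ + X)%N]big1 ?addn0; last first.
  by move=> i /andP[bi _]; rewrite [(i < b)%N]ltnNge bi andbF.
rewrite (eq_big_nat _ _ (F2 := fun=> 1%N)); last by move=> i ->.
by rewrite sum_nat_const_nat muln1.
Qed.

Lemma threshold_part j : j != ord0 -> part_size R threshold_coloring j = k%:R.
Proof.
move=> j0.
have k0 : (0 < k)%N || (k == 0)%N by case: k.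
have h m : (0 < m < 5)%N -> j = m :> nat -> part_size R threshold_coloring j = k%:R.
  move=> m5 jm.
  have -> : part_size R threshold_coloring j = \sum_(i < n) ((m.-1 * k <= i) && (i < m * k))%N%:R.
    apply: eq_bigr => i _; congr (_%:R); congr nat_of_bool.
    rewrite /threshold_coloring -val_eqE /= inordK; last by do 4![case: ifP => // _].
    rewrite jm; case: m m5 {jm} => [|[|[|[|[|m]]]]] //= _;
      do 4?[case: ltnP => ?]; rewrite ?mul0n ?mul1n; apply/idP/idP => // *; lia.
  rewrite sum_interval; last by case: m m5 {jm} => [|[|[|[|[|m]]]]] //= _; lia.
  by rewrite -natrB; case: m m5 {jm} => [|m] //= _; [congr (_%:R)|]; rewrite mulSn ?addnK ?leq_addl.
case: j j0 h => [[|m]] //= hm _ h; exact: (h m.+1).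
Qed.
End NearOptimalGraph.

(** Rounding down the small parts moves the largest ratio by at most 4/n. The optimum is a double
    zero of [opt_density_quartic], so the density drops by at most 32/n^2; this costs 32 n^2 <= n^3,
    on top of the 3 n^3 of [star_count_multipartite_ge]. *)
Lemma near_optimal_exists (R : realType) (n : nat) : (32 <= n)%N ->
  exists phi : 'I_n -> 'I_5,
    opt_density R * n%:R ^+ 4 - 4 * n%:R ^+ 3 <= star_count R (multipartite phi).
Proof.
move=> n32.
have n_ge : 32 <= n%:R :> R by rewrite (ler_nat _ 32).
have n0 : 0 < n%:R :> R by apply: lt_le_trans n_ge.
have [b1 b2] := big_part_bounds R.
pose s := small_part R.
have s0 : 0 <= s by rewrite /s /small_part; lra.
have s1 : 4 * s <= 1 by rewrite /s /small_part; lra.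
pose k := Num.truncn (s * n%:R).
have /andP[k1 k2] : k%:R <= s * n%:R < k.+1%:R by apply: truncn_itv; rewrite mulr_ge0.
have kn : (4 * k <= n)%N.
  rewrite -(ler_nat R) natrM; apply: le_trans (_ : 4 * (s * n%:R) <= _); first by rewrite ler_pM2l.
  by rewrite mulrA ler_piMl // ltW.
exists (@threshold_coloring n k).
have nT : 0 < #|'I_n|%:R :> R by rewrite card_ord.
have := star_count_multipartite_ge (@threshold_coloring n k) nT; rewrite card_ord.
apply: le_trans.
set r := part_ratio R _.
have rk (j : 'I_4) : r (lift ord0 j) = k%:R / n%:R.
  by rewrite /r /part_ratio threshold_part ?card_ord // eq_sym neq_lift.
have r0 : r ord0 = 1 - 4 * (k%:R / n%:R).
  have := sum_part_ratio (@threshold_coloring n k) nT; rewrite -/r !big_ord_recl big_ord0 !rk.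
  by move: (k%:R / n%:R) (r ord0) => q a; lra.
have dens : partite_density r = let a := r ord0 in let b := 1 - a in
    a^+2 - a^+3 + b^+2/4*(1-2*a^+2) - b^+4/16 - b^+3/16 + b^+4/64.
  rewrite /partite_density !big_ord_recl !big_ord0 !rk r0 /=; field.
  by rewrite gt_eqF.
move: dens => /=; set a := r ord0 => dens.
have /= quart := opt_density_quartic a; rewrite -dens in quart.
have q1 : k%:R / n%:R <= s by rewrite ler_pdivrMr.
have q2 : s - n%:R^-1 <= k%:R / n%:R.
  by rewrite ler_pdivlMr // mulrBl mulVf ?gt_eqF // lerBlDr natr1 ltW.
have a1 : 0 <= a - big_part R <= 4 * n%:R^-1.
  rewrite /a r0; move: q1 q2; rewrite /s /small_part.
  move: (k%:R / n%:R : R) (n%:R^-1 : R) (big_part R) => u w z h1 h2; apply/andP; split; lra.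
have asq : (a - big_part R) ^+ 2 * n%:R ^+ 2 <= 16.
  have -> : (a - big_part R) ^+ 2 * n%:R ^+ 2 = ((a - big_part R) * n%:R) ^+ 2 by ring.
  have -> : 16 = 4 ^+ 2 :> R by ring.
  move: a1 => /andP[a1 a2]; rewrite lerXn2r // ?nnegrE ?mulr_ge0 ?(ltW n0) //.
  by move: (ler_wpM2r (ltW n0) a2); rewrite -mulrA mulVf ?mulr1 // gt_eqF.
have ale : 0 <= a <= 1.
  rewrite /a r0; have u0 : 0 <= k%:R / n%:R :> R by rewrite divr_ge0 // ltW.
  by move: q1 u0 s1; move: (k%:R / n%:R : R) => u h1 h2 h3; apply/andP; split; lra.
have key : (opt_density R - partite_density r) * n%:R ^+ 2 <= 32.
  have c128 : 35*a^+2 + (70*big_part R-16)*a + 12 - 17*big_part R <= 128.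
    move: ale b1 b2 => /andP[]; clear; move: (big_part R) a => z w h1 h2 h3 h4; nra.
  have := ler_wpM2l (mulr_ge0 (sqr_ge0 (a - big_part R)) (sqr_ge0 n%:R)) c128.
  move: quart asq; move: (opt_density R) (partite_density r) => u w quart asq.
  have : 64 * (u - w) * n%:R ^+ 2 = (a - big_part R) ^+ 2 * n%:R ^+ 2 * (35*a^+2 + (70*big_part R-16)*a + 12 - 17*big_part R).
    by rewrite quart; ring.
  move: ((a - big_part R) ^+ 2 * n%:R ^+ 2) asq (35 * _ + _ + _ - _) => A hA B.
  by move: (n%:R ^+ 2 : R) => N; lra.
have n2 : 0 <= n%:R ^+ 2 :> R by exact: sqr_ge0.
have h1 := ler_wpM2r n2 key.
have h2 := ler_wpM2r n2 n_ge.
have e1 : (opt_density R - partite_density r) * n%:R ^+ 2 * n%:R ^+ 2 =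
  opt_density R * n%:R ^+ 4 - n%:R ^+ 4 * partite_density r by ring.
have e2 : n%:R * n%:R ^+ 2 = n%:R ^+ 3 :> R by ring.
rewrite e1 in h1; rewrite e2 in h2.
move: h1 h2; move: (opt_density R * _) (_ * partite_density r) (n%:R ^+ 2 : R) (n%:R ^+ 3 : R) => A B C D; lra.
Qed.

(** * Graphs and their adjacency relations *)

Section GraphOfRel.
Variable T : finType.
Implicit Types (e : rel T) (G : sgraph T).

Lemma adj_sym G : symmetric (adj G).
Proof. by move=> x y; rewrite /adj finset.setUC. Qed.

Lemma adj_irr G : irreflexive (adj G).
Proof.
move=> x; apply/negbTE/negP => h.
have /forall_inP/(_ _ h) := edges_card2 G.
by rewrite finset.setUid cards1.
Qed.

Lemma graph_of_rel e : symmetric e -> irreflexive e -> exists G, adj G = e.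
Proof.
move=> es ei.
pose E := [set p : {set T} | [exists x, exists y, e x y && (p == [set x; y]%SET)]]%SET.
have hE : [forall p in E, #|p| == 2].
  apply/forall_inP => p; rewrite inE => /existsP[x /existsP[y /andP[exy /eqP ->]]].
  by rewrite cards2; have [xy|//] := eqVneq x y; rewrite xy ei in exy.
exists (SGraph hE); apply: eq_rel => x y; rewrite /adj /= inE.
apply/existsP/idP => [[u /existsP[w /andP[euw /eqP E2]]]|exy]; last first.
  by exists x; apply/existsP; exists y; rewrite exy eqxx.
have uw : u != w by apply: contraTneq euw => ->; rewrite ei.
have xu : x \in [set u; w]%SET by rewrite -E2 !inE eqxx.
have yu : y \in [set u; w]%SET by rewrite -E2 !inE eqxx orbT.
have ux : u \in [set x; y]%SET by rewrite E2 !inE eqxx.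
have wx : w \in [set x; y]%SET by rewrite E2 !inE eqxx orbT.
move: xu yu ux wx; rewrite !inE.
have [->|xu] := eqVneq x u; have [->|yu] := eqVneq y u; rewrite ?orbb ?orbF /=.
- by move=> _ _ _ /eqP wu; rewrite wu eqxx in uw.
- by move=> _ /eqP -> _ _.
- by move=> /eqP -> _ _ _; rewrite es.
- by [].
Qed.
End GraphOfRel.

(** * Embeddings and the star count *)

Section Embeddings.
Variables (R : realType) (T : finType).
Implicit Types (G : sgraph T) (f : {ffun 'I_4 -> T}).

(* c, x, z, y are the images of the vertices 0, 1, 2, 3. *)
Definition is_star (e : rel T) (c x y z : T) :=
  [&& e c x, e c y, e c z, ~~ e x y, x != y, z != x & z != y].

(** Of injectivity only the distinctness of the leaves has to be listed; the centre differs from its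
    neighbours by irreflexivity. *)
Lemma star_embedding G f : is_embedding star_H G f =
  is_star (adj G) (f (vtx 0)) (f (vtx 1)) (f (vtx 3)) (f (vtx 2)).
Proof.
have im a b : (f @: [set a; b])%SET = [set f a; f b]%SET.
  by rewrite imsetU1 imset_set1.
have redE : [forall e in edges (red star_H), (f @: e)%SET \in edges G] =
  [&& adj G (f (vtx 0)) (f (vtx 1)), adj G (f (vtx 0)) (f (vtx 2)) & adj G (f (vtx 0)) (f (vtx 3))].
  apply/forall_inP/and3P => [h|[h1 h2 h3] e].
    by split; rewrite /adj -im; apply: h; rewrite !inE eqxx ?orbT.
  by rewrite !inE => /orP[/orP[]|] /eqP ->; rewrite im.
have blueE : [forall e in edges (blue star_H), (f @: e)%SET \notin edges G] =
  ~~ adj G (f (vtx 1)) (f (vtx 3)).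
  apply/forall_inP/idP => [h|h e].
    by rewrite /adj -im; apply: h; rewrite !inE.
  by rewrite !inE => /eqP ->; rewrite im.
rewrite /is_embedding redE blueE /is_star.
have vE (i : 'I_4) : [|| i == vtx 0, i == vtx 1, i == vtx 2 | i == vtx 3].
  by case: i => [[|[|[|[|i]]]] hi] //; rewrite -!val_eqE /= !inordK.
apply/and3P/and4P.
  move=> [/injectiveP inj /and3P[-> -> ->] ->]; split => //.
  by apply/and4P; split => //; rewrite (inj_eq inj) vtx_inj.
move=> [e1 e3 e2 /and4P[e13 n13 n21 n23]].
have ne a b : adj G a b -> a != b by apply: contraTneq => ->; rewrite adj_irr.
have d1 := ne _ _ e1; have d2 := ne _ _ e2; have d3 := ne _ _ e3.
split => //; last by rewrite e1 e2 e3.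
apply/injectiveP => i k.
have /or4P[] := vE i => /eqP ->; have /or4P[] := vE k => /eqP -> //
  => /eqP; rewrite ?[f (vtx 1) == f (vtx 0)]eq_sym ?[f (vtx 2) == f (vtx 0)]eq_sym
   ?[f (vtx 3) == f (vtx 0)]eq_sym ?[f (vtx 1) == f (vtx 2)]eq_sym ?[f (vtx 3) == f (vtx 1)]eq_sym
   ?[f (vtx 3) == f (vtx 2)]eq_sym ?(negPf d1) ?(negPf d2) ?(negPf d3) ?(negPf n13) ?(negPf n21) ?(negPf n23) //.
Qed.

Lemma sum_ffun4 (W : T -> T -> T -> T -> R) :
  \sum_(f : {ffun 'I_4 -> T}) W (f (vtx 0)) (f (vtx 1)) (f (vtx 3)) (f (vtx 2)) =
  \sum_c \sum_x \sum_y \sum_z W c x y z.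
Proof.
rewrite pair_bigA /= pair_bigA /= pair_bigA /=.
pose h (f : {ffun 'I_4 -> T}) := (f (vtx 0), f (vtx 1), f (vtx 3), f (vtx 2)).
rewrite (reindex h) //=.
pose h' (p : T * T * T * T) : {ffun 'I_4 -> T} :=
  [ffun i : 'I_4 => nth p.2 [:: p.1.1.1; p.1.1.2; p.2; p.1.2] i].
exists h' => [f _|[[[c x] y] z] _]; last by rewrite /h /h' !ffunE /= !inordK.
apply/ffunP => i; rewrite ffunE /h /=.
case: i => [[|[|[|[|i]]]] hi] //=; congr (f _); apply: val_inj; by rewrite /= inordK.
Qed.

Lemma num_embeddings_star G : (num_embeddings star_H G)%:R = star_count R (adj G).
Proof.
have -> : (num_embeddings star_H G)%:R = \sum_(f : {ffun 'I_4 -> T})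
   (is_star (adj G) (f (vtx 0)) (f (vtx 1)) (f (vtx 3)) (f (vtx 2)))%:R :> R.
  rewrite /num_embeddings -sum1_card natr_sum big_mkcond /=; apply: eq_bigr => f _.
  by rewrite inE star_embedding; case: is_star.
rewrite (sum_ffun4 (fun c x y z => (is_star (adj G) c x y z)%:R)).
apply: eq_bigr => c _; set e := adj G.
(* For distinct non-adjacent neighbours x, y of c, the third leaf is any of the other neighbours. *)
have zsum x y : \sum_z (is_star e c x y z)%:R =
  (deg R e c - 2) * (edge_ind R e c x * edge_ind R e c y * (1 - edge_ind R e x y) * (1 - (x == y)%:R)).
  have [xy|xy] := eqVneq x y.
    rewrite /= subrr !mulr0 big1 // => z _; rewrite /is_star xy eqxx /=.
    by rewrite !andbF.
  rewrite /edge_ind /is_star; case cx: (e c x); last by rewrite big1 ?mul0r ?mulr0.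
  case cy: (e c y); last by rewrite big1 ?mul0r ?mulr0 ?mul0r ?mulr0.
  case exy: (e x y); first by rewrite /= subrr mulr0 mul0r mulr0 big1 // => z _; rewrite andbF.
  rewrite /= subr0 !mulr1 xy.
  have -> : 2 = edge_ind R e c x + edge_ind R e c y by rewrite /edge_ind cx cy.
  have pick w : edge_ind R e c w = \sum_z (z == w)%:R * edge_ind R e c w.
    rewrite (bigD1 w) //= eqxx mul1r big1 ?addr0 // => z /negPf ->; exact: mul0r.
  rewrite [edge_ind R e c x]pick [edge_ind R e c y]pick /deg -big_split -sumrB; apply: eq_bigr => z _.
  rewrite /edge_ind; have [->|zx] := eqVneq z x; first by rewrite cx (negPf xy) /=; ring.
  have [->|zy] := eqVneq z y; first by rewrite cy /=; ring.
  by case: (e c z); rewrite /=; ring.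
rewrite (eq_bigr _ (fun x _ => eq_bigr _ (fun y _ => zsum x y))).
under eq_bigr => x _ do rewrite -mulr_sumr.
rewrite -mulr_sumr; congr (_ * _).
rewrite /nonadj_pairs /deg -sumrB; apply: eq_bigr => x _.
rewrite [in LHS](bigD1 x) //= [in RHS](bigD1 x) //= eqxx subrr mulr0 add0r.
have ex : edge_ind R e x x = 0 by rewrite /edge_ind /e adj_irr.
have -> : edge_ind R e c x * edge_ind R e c x * (1 - edge_ind R e x x) = edge_ind R e c x.
  by rewrite ex subr0 mulr1 /edge_ind; case: (e c x); rewrite ?mulr1 ?mulr0.
rewrite addrC addrK; apply: eq_bigr => y /negPf xy.
by rewrite eq_sym xy subr0 mulr1.
Qed.
End Embeddings.

(** * Edit distance and blowups *)

Section EditDistance.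
Variable T : finType.
Implicit Types G : sgraph T.

(** The identity is one candidate bijection, and each edge of the symmetric difference comes from an
    ordered wrong pair. *)
Lemma edit_distance_le G G' : (edit_distance G G' <= dist (adj G) (adj G'))%N.
Proof.
apply: (@leq_trans (edit_cost G G' 1%g)).
  rewrite /edit_distance; elim/big_rec: _ => // s m _; apply: leq_trans; exact: geq_minr.
have idE : [set (1%g : {perm T}) @: p | p : {set T} in edges G]%SET = edges G.
  apply/setP => p; apply/imsetP/idP => [[q qG ->]|pG].
    by rewrite (eq_imset (g := id)) ?imset_id // => x; rewrite perm1.
  by exists p => //; rewrite (eq_imset (g := id)) ?imset_id // => x; rewrite perm1.
rewrite /edit_cost idE.
pose D := [set p : T * T | adj G p.1 p.2 != adj G' p.1 p.2]%SET.
have -> : dist (adj G) (adj G') = #|D|.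
  rewrite /dist pair_bigA /= -sum1_card [RHS]big_mkcond /=.
  by apply: eq_bigr => p _; rewrite inE; case: (_ != _).
apply: leq_trans (leq_imset_card (fun p : T * T => [set p.1; p.2]%SET) D).
apply: subset_leq_card; apply/fintype.subsetP => p.
rewrite !inE => hp.
have p2 : #|p| == 2.
  case/orP: hp => /andP[_ h]; first exact: (forall_inP (edges_card2 G)).
  exact: (forall_inP (edges_card2 G')).
case/cards2P: p2 => x [y] [xy pE].
rewrite [X in X \in _]pE; apply: (imset_f _ (_ : (x, y) \in D)); rewrite inE /= /adj -pE.
by case/orP: hp => /andP[/negPf -> ->].
Qed.

Lemma multipartite_blowup G (phi : T -> 'I_5) :
  adj G = multipartite phi -> is_blowup (complete 'I_5) G.
Proof.
move=> GE; exists (fun i => [set x | phi x == i]%SET); split.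
- move=> i j ij; rewrite -setI_eq0; apply/eqP/setP => x; rewrite !inE.
  by apply/negbTE/negP => /andP[/eqP -> /eqP E]; rewrite E eqxx in ij.
- apply/setP => x; rewrite inE; apply/bigcupP; exists (phi x) => //; by rewrite inE.
- move=> i j x y; rewrite !inE => /eqP <- /eqP <-; rewrite GE /multipartite /adj /= inE cards2.
  by case: eqP.
Qed.
End EditDistance.

(** * Limit density and perfect stability *)

Section Densities.
Variable R : realType.
Implicit Type n : nat.

Lemma ffact4 n : (4 <= n)%N -> (n ^_ 4)%:R =
  n%:R ^+ 4 - 6 * n%:R ^+ 3 + 11 * n%:R ^+ 2 - 6 * n%:R :> R.
Proof.
case: n => [|[|[|[|n]]]] // _.
rewrite !ffactnS ffactn0 /= !natrM -[n.+4%:R]natr1 -[n.+3%:R]natr1 -[n.+2%:R]natr1 -[n.+1%:R]natr1.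
by move: (n%:R : R) => m; ring.
Qed.

Lemma ffact4_le n : (n ^_ 4)%:R <= n%:R ^+ 4 :> R.
Proof.
rewrite -natrX ler_nat !ffactnS ffactn0 muln1 !expnS expn0 muln1.
by do !apply: leq_mul => //; lia.
Qed.

Lemma density_star n (G : sgraph 'I_n) :
  density R star_H G = star_count R (adj G) / (n ^_ 4)%:R.
Proof. by rewrite /density num_embeddings_star card_ord. Qed.

Lemma density_le_max n (G : sgraph 'I_n) : density R star_H G <= max_density R star_H n.
Proof. exact: le_bigmax. Qed.

Lemma ffact_gt0R n : (4 <= n)%N -> 0 < (n ^_ 4)%:R :> R.
Proof. by move=> n4; rewrite ltr0n ffact_gt0. Qed.

Lemma star_count_le_max n (e : rel 'I_n) : (4 <= n)%N -> symmetric e -> irreflexive e ->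
  star_count R e <= max_density R star_H n * (n ^_ 4)%:R.
Proof.
move=> n4 es ei; have [G <-] := graph_of_rel es ei.
by rewrite -ler_pdivrMr ?ffact_gt0R // -density_star; exact: density_le_max.
Qed.

(** Below, the falling factorial is at most n^4. Above, its lower-order terms cost about 6
    [opt_density] n^3 < n^3; with the n^3 of [star_count_le_opt] this stays under 10 n^3. *)
Lemma max_density_bounds n : (32 <= n)%N ->
  opt_density R - 4 / n%:R <= max_density R star_H n <= opt_density R + 10 / n%:R.
Proof.
move=> n32; have n4 : (4 <= n)%N by exact: leq_trans n32.
have n_ge : 32 <= n%:R :> R by rewrite (ler_nat _ 32).
have n0 : 0 < n%:R :> R by apply: lt_le_trans n_ge.
have [l1 l2] := opt_density_bounds R.
have n_2 : 0 <= n%:R ^+ 2 :> R by exact: sqr_ge0.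
have n_3 : 32 * n%:R ^+ 2 <= n%:R ^+ 3 :> R by have := ler_wpM2r n_2 n_ge; rewrite -exprS.
have n_1 : 32 * n%:R <= n%:R ^+ 2 :> R by have := ler_wpM2r (ltW n0) n_ge; rewrite -expr2.
have f0 := ffact_gt0R n4.
have invn : 4 / n%:R <= 1/8 :> R by rewrite ler_pdivrMr //; lra.
apply/andP; split.
  have [phi hphi] := near_optimal_exists R n32.
  have [G GE] := graph_of_rel (multipartite_sym phi) (multipartite_irr phi).
  apply: le_trans (density_le_max G); rewrite density_star GE ler_pdivlMr //.
  apply: le_trans hphi.
  have -> : opt_density R * n%:R ^+ 4 - 4 * n%:R ^+ 3 = (opt_density R - 4 / n%:R) * n%:R ^+ 4.
    by field; rewrite gt_eqF.
  apply: ler_wpM2l; first by move: (opt_density R) (4 / n%:R) l1 invn => x y; clear; lra.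
  exact: ffact4_le.
have B0 : 0 <= opt_density R + 10 / n%:R.
  have : 0 <= 10 / n%:R :> R by rewrite divr_ge0 // ltW.
  by move: (opt_density R) (10 / n%:R) l1 => x y; clear; lra.
apply: bigmax_le => // G _; rewrite density_star ler_pdivrMr //.
apply: le_trans (star_count_le_opt (adj_sym G) (@adj_irr _ G) _) _; rewrite card_ord //.
rewrite ffact4 //.
have -> : (opt_density R + 10 / n%:R) * (n%:R ^+ 4 - 6 * n%:R ^+ 3 + 11 * n%:R ^+ 2 - 6 * n%:R) =
  opt_density R * n%:R ^+ 4 + 10 * n%:R ^+ 3 - 60 * n%:R ^+ 2 + 110 * n%:R - 60
   + opt_density R * (11 * n%:R ^+ 2 - 6 * n%:R) - 6 * (opt_density R * n%:R ^+ 3).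
  by field; rewrite gt_eqF.
have p1 : opt_density R * n%:R ^+ 3 <= 1501 / 10 / 1000 * n%:R ^+ 3.
  apply: ler_wpM2r; first by rewrite exprn_ge0 // ltW.
  by apply: le_trans l2 _; lra.
have p2 : 0 <= opt_density R * (11 * n%:R ^+ 2 - 6 * n%:R).
  apply: mulr_ge0; first by move: (opt_density R) l1 => x; clear; lra.
  by move: n_1 n0; move: (n%:R ^+ 2 : R) (n%:R : R); clear => x y; lra.
move: p1 p2 n_1 n_2 n_3 n_ge; move: (opt_density R * n%:R ^+ 4) (opt_density R * n%:R ^+ 3) (opt_density R * _).
move: (n%:R ^+ 3 : R) (n%:R ^+ 2 : R) (n%:R : R); clear => a b c x y z; lra.
Qed.

(** For a best 5-colouring there are two regimes. A large deficit makes the trivial distance bound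
    n^2 sufficient; otherwise the graph is within the local radius, where the gain of [local_gain]
    cannot exceed the deficit. The constant 1000 / [deficit_threshold] serves both. *)
Lemma star_stable : perfectly_stable R star_H (complete 'I_5).
Proof.
have t0 := local_radius_gt0 R; have t20 := deficit_threshold_gt0 R; have t2 := deficit_threshold_le R.
have t1 : local_radius R <= 1/100/100/100/100/100 by rewrite /local_radius; lra.
have t21 : deficit_threshold R <= 1/100/100/100/100/100.
  by move: (local_radius R) (deficit_threshold R) t0 t20 t1 t2; clear => a b *; lra.
have K0 : 0 < 1000 / deficit_threshold R by apply: divr_gt0; [lra | exact: t20].
exists (1000 / deficit_threshold R); split; first exact: K0.
split.
  rewrite (ler_pdivlMr _ _ t20); move: (deficit_threshold R) t21; clear => a; lra.
move=> n G; rewrite (ler_pdivrMr _ _ t20) => n_large0.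
have n_large : 1000 <= deficit_threshold R * n%:R by rewrite mulrC.
have n_big : 32 <= n%:R :> R.
  have := ler_wpM2r (ler0n R n) t21; move: n_large (ler0n R n).
  by move: (n%:R : R) (deficit_threshold R); clear => a b; lra.
have n32 : (32 <= n)%N by rewrite -(ler_nat R).
have n4 : (4 <= n)%N by exact: leq_trans n32.
have n0 : 0 < n%:R :> R by apply: lt_le_trans n_big.
have nT : #|'I_n|%:R = n%:R :> R by rewrite card_ord.
pose e := adj G.
have es : symmetric e by exact: adj_sym.
have ei : irreflexive e by exact: adj_irr.
have [phi min_phi] := best_coloring e.
have [G' G'E] := graph_of_rel (multipartite_sym phi) (multipartite_irr phi).
exists G'; split; first exact: multipartite_blowup G'E.
apply: (@le_trans _ _ ((dist e (multipartite phi))%:R)).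
  by rewrite ler_nat -G'E; exact: edit_distance_le.
set M := max_density R star_H n; set d := density R star_H G.
have dE : star_count R e = d * (n ^_ 4)%:R.
  by rewrite /d density_star divfK // gt_eqF // ffact_gt0R.
have d_le : 0 <= M - d by rewrite subr_ge0; exact: density_le_max.
have ff : (n ^_ 4)%:R <= n%:R ^+ 4 :> R by exact: ffact4_le.
have n2 : 0 < n%:R ^+ 2 :> R by rewrite exprn_gt0.
have gap : M * (n ^_ 4)%:R - star_count R e <= (M - d) * n%:R ^+ 4.
  by rewrite dE -mulrBl; exact: ler_wpM2l.
have [far|near] := ltP (star_count R e) (opt_density R * n%:R ^+ 4 - deficit_threshold R * n%:R ^+ 4).
  have [psi hpsi] := near_optimal_exists R n32.
  have up := star_count_le_max n4 (multipartite_sym psi) (multipartite_irr psi).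
  rewrite -/M in up.
  have n3 : 0 <= n%:R ^+ 3 :> R by rewrite exprn_ge0 // ltW.
  have n34 := ler_wpM2r n3 n_large.
  have e34 : deficit_threshold R * n%:R * n%:R ^+ 3 = deficit_threshold R * n%:R ^+ 4 by ring.
  rewrite e34 in n34.
  have g1 : deficit_threshold R / 2 * n%:R ^+ 4 <= (M - d) * n%:R ^+ 4.
    apply: le_trans gap; move: far hpsi up n34 n3.
    move: (opt_density R * _) (star_count R e) (star_count R _) (M * _) (n%:R ^+ 3 : R) => A B C D E.
    have -> : deficit_threshold R / 2 * n%:R ^+ 4 = (deficit_threshold R * n%:R ^+ 4) / 2 by ring.
    by move: (deficit_threshold R * _); clear => F; lra.
  rewrite ler_pM2r ?exprn_gt0 // in g1.
  have dn : (dist e (multipartite phi))%:R <= n%:R ^+ 2 :> R.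
    rewrite distE; apply: (@le_trans _ _ (\sum_(x < n) \sum_(y < n) 1)).
      by apply: ler_sum => x _; apply: ler_sum => y _; rewrite /edge_diff; case: (_ != _).
    by rewrite !sumr_const card_ord -mulrnA -natrX mulnn.
  apply: le_trans dn _; rewrite ler_peMl ?(ltW n2) //.
  rewrite mulrAC (ler_pdivlMr _ _ t20) mul1r; move: (deficit_threshold R) (M - d) t20 g1; clear => a b h1 h2; lra.
have n_tiny2 : 1 <= deficit_threshold R * #|'I_n|%:R.
  by rewrite nT; apply: le_trans n_large; rewrite (ler_nat _ 1).
have n_tiny : 1 <= local_radius R * #|'I_n|%:R.
  apply: le_trans n_tiny2 _; apply: ler_wpM2r => //.
  by move: (local_radius R) (deficit_threshold R) t0 t20 t2; clear => a b *; lra.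
have near' : opt_density R * #|'I_n|%:R ^+ 4 - deficit_threshold R * #|'I_n|%:R ^+ 4 <= star_count R e by rewrite nT.
have [psi hpsi] := close_to_partite es ei n_tiny2 near'.
have hphi : (dist e (multipartite phi))%:R <= local_radius R * #|'I_n|%:R ^+ 2.
  by apply: le_trans hpsi; rewrite ler_nat.
have near2 : opt_density R * #|'I_n|%:R ^+ 4 - local_radius R * #|'I_n|%:R ^+ 4 <= star_count R e.
  apply: le_trans near'; rewrite lerD2l lerN2; apply: ler_wpM2r; first by rewrite exprn_ge0.
  by move: (local_radius R) (deficit_threshold R) t0 t20 t2; clear => a b *; lra.
have [e' [e's e'i he']] := local_gain es ei n_tiny (leqnn _) min_phi near2 hphi.
have up := star_count_le_max n4 e's e'i; rewrite -/M in up.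
have g1 : 1/100/100/100/100/100 * n%:R ^+ 2 * (dist e (multipartite phi))%:R <= (M - d) * n%:R ^+ 4.
  by apply: le_trans gap; rewrite lerBrDr addrC -nT; exact: le_trans he' up.
have g2 : 1/100/100/100/100/100 * (dist e (multipartite phi))%:R <= (M - d) * n%:R ^+ 2.
  rewrite -(ler_pM2l n2); move: g1; move: (dist _ _)%:R (M - d) (n%:R : R); clear => a b c; lra.
rewrite -mulrA mulrAC (ler_pdivlMr _ _ t20).
have s0 : 0 <= (M - d) * n%:R ^+ 2 by rewrite mulr_ge0 // ltW.
have D0 : 0 <= (dist e (multipartite phi))%:R :> R by [].
have := ler_wpM2l D0 t21; move: g2 s0 D0; move: (dist _ _)%:R ((M - d) * _) (deficit_threshold R); clear => a b c; lra.
Qed.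
End Densities.

Theorem theorem3p24 (R : realType) :
  (max_density R star_H n @[n --> \oo]
     --> (- 171%:R * Num.sqrt 57%:R + 7879%:R) / 43904%:R) /\
  perfectly_stable R star_H (complete 'I_5).
Proof.
split; last exact: star_stable.
rewrite -/(opt_density R); apply/cvgrPdist_le => eps eps0.
near=> n.
have n32 : (32 <= n)%N by near: n; exact: nbhs_infty_ge.
have hn : 10 / eps <= n%:R by near: n; exact: nbhs_infty_ger.
have n0 : 0 < n%:R :> R by rewrite ltr0n; exact: leq_trans n32.
have h10 : 10 / n%:R <= eps by rewrite ler_pdivrMr // mulrC -ler_pdivrMr.
have h4 : 4 / n%:R <= 10 / n%:R :> R by rewrite ler_pM2r ?invr_gt0 // ler_nat.
have /andP[] := max_density_bounds R n32.
rewrite ler_norml; move: (opt_density R) (max_density _ _ _) (4 / _) (10 / n%:R) h10 h4 => a b c d.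
by move=> u1 u2 u3 u4; apply/andP; split; lra.
Unshelve. all: by end_near.
Qed.
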